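(* Let $\Gamma$ be a finite simplicial complex and let $k$ be an integer with $1\le k\le\dim\Gamma$. Let $\underline C_{k-1}$ be a quotient-up-component in dimension $k-1$ which is not a leaf, and let $\underline C_k=\{\underline\sigma\in\underline X_k:\underline\sigma\supset\underline\rho\text{ for some }\underline\rho\in\underline C_{k-1}\}$ be the corresponding quotient-down-component in dimension $k$. Then \[ \frac{\max\Big(\frac{(h^{\mathrm{up}}_{C_{k-1}})^2}{k},\frac{(h^{\mathrm{down}}_{C_k})^2}{d^{\mathrm{down}}_{C_k}}\Big)}{2(k+1)}\;\le\;1-\lambda_{\max}\big(\Delta^{\mathrm{up}}_{k-1}|_{\mathcal O(\underline C_{k-1})}\big)\;=\;1-\lambda_{\max}\big(\Delta^{\mathrm{down}}_{k}|_{\mathcal O(\underline C_{k})}\big)\;\le\;\frac{2\min\big(h^{\mathrm{up}}_{C_{k-1}},h^{\mathrm{down}}_{C_k}\big)}{k+1}. \]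
   Context: Let $V$ be a finite set. A simplicial complex is a set $\underline X$ of nonempty subsets of $V$ (faces) containing all singletons and closed under taking nonempty subsets. A $k$-face has $k+1$ elements; $\underline X_k$ is the set of $k$-faces; $\dim\Gamma$ is the maximal face dimension. For $k\ge1$ an oriented $k$-face is an ordering $[x_0,\dots,x_k]$ of a $k$-face, two orderings being identified iff they differ by an even permutation; $-\sigma$ is the opposite orientation. For a vertex $x$ there are two oriented $0$-faces $[x]$ and $-[x]$. An orientation $\mathcal O$ chooses one oriented face $\mathcal O(\underline\sigma)$ over each face $\underline\sigma$. Write $\underline\sigma\subset\underline\tau$ if $\underline\sigma$ is a $k$-face contained in the $(k+1)$-face $\underline\tau$. For an oriented $(k+1)$-face $\tau=[x_0,\dots,x_{k+1}]$ and an oriented $k$-face $\sigma$ with underlying set $\underline\tau\setminus\{x_i\}$, the incidence number $[\tau:\sigma]\in\{\pm1\}$ is $+1$ iff $\sigma$ equals $[x_0,\dots,\widehat{x_i},\dots,x_{k+1}]$ when $i$ is even, resp. its opposite when $i$ is odd. A leaf is a face not properly contained in another face. The function $\mathrm{LP}$ on faces is defined recursively: $\mathrm{LP}(\underline\sigma)=1$ if $\underline\sigma$ is a leaf, and $\mathrm{LP}(\underline\sigma)=\sum_{\underline\tau\supset\underline\sigma}\mathrm{LP}(\underline\tau)$ (sum over $(k+1)$-faces containing the $k$-face $\underline\sigma$) otherwise. Two distinct $k$-faces are up-adjacent if their union is a $(k+1)$-face, down-adjacent ($k\ge1$) if their intersection is a $(k-1)$-face. A quotient-up-component (resp. quotient-down-component)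 in dimension $k$ is a maximal subset of $\underline X_k$ connected under the transitive closure of up-adjacency (resp. down-adjacency); a quotient-up-component ''is a leaf'' if it is a single leaf. Fix an orientation $\mathcal O$ and write $\sigma=\mathcal O(\underline\sigma)$. Let $\partial_k^*$ be the $|\underline X_{k+1}|\times|\underline X_k|$ matrix with $(\partial_k^* )_{\tau\sigma}=[\tau:\sigma]$ if $\underline\sigma\subset\underline\tau$ and $0$ otherwise. Let $W_k$ be diagonal with entries $\mathrm{LP}(\underline\sigma)/(k+1)!$ for $\underline\sigma\in\underline X_k$. Set $\delta_k=W_{k+1}^{1/2}\partial_k^*W_k^{-1/2}$, $\Delta_k^{\mathrm{up}}=\delta_k^T\delta_k$, $\Delta_k^{\mathrm{down}}=\delta_{k-1}\delta_{k-1}^T$. For a set $\underline C$ of $k$-faces, $\Delta|_{\mathcal O(\underline C)}$ denotes the principal submatrix indexed by $\underline C$, and $\lambda_{\max}$ the largest eigenvalue. Cheeger constants. Let $s^{\mathrm{up}}(\sigma,\sigma')=[\tau:\sigma][\tau:\sigma']$ for up-adjacent $\underline\sigma,\underline\sigma'$ and $\tau$ any orientation of $\underline\sigma\cup\underline\sigma'$; $s^{\mathrm{down}}(\sigma,\sigma')=[\sigma:\rho][\sigma':\rho]$ for down-adjacent $\underline\sigma,\underline\sigma'$ and $\rho$ any orientation of $\underline\sigma\cap\underline\sigma'$ (both computed with $\sigma=\mathcal O(\underline\sigma),\sigma'=\mathcal O(\underline\sigma')$). Put $\mu(\underline Y)=\sum_{\underline\sigma\in\underline Y}\mathrm{LP}(\underline\sigma)$,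 weights $\omega^{\mathrm{up}}_{\underline\sigma\underline\sigma'}=\mathrm{LP}(\underline\sigma\cup\underline\sigma')$ on up-adjacent pairs and $\omega^{\mathrm{down}}_{\underline\sigma\underline\sigma'}=\mathrm{LP}(\underline\sigma)\mathrm{LP}(\underline\sigma')/\mathrm{LP}(\underline\sigma\cap\underline\sigma')$ on down-adjacent pairs. For a component $\underline C$ and $\emptyset\ne\underline Y\subseteq\underline C$: $\omega(\underline Y,\underline C\setminus\underline Y)=\sum\omega_{\underline\sigma\underline\sigma'}$ over adjacent pairs with $\underline\sigma\in\underline Y,\underline\sigma'\in\underline C\setminus\underline Y$; $\omega_-(\underline Y,\mathcal O)=\sum\omega_{\underline\sigma\underline\sigma'}$ over ordered adjacent pairs $(\underline\sigma,\underline\sigma')\in\underline Y\times\underline Y$ with $s(\sigma,\sigma')=-1$ (both orders counted). Then $h^{\mathrm{up}}_{C_{k-1}}=\min_{\underline Y,\mathcal O}\frac{\omega^{\mathrm{up}}(\underline Y,\underline C_{k-1}\setminus\underline Y)+\omega^{\mathrm{up}}_-(\underline Y,\mathcal O)}{\mu(\underline Y)}$ (minimum over nonempty $\underline Y\subseteq\underline C_{k-1}$ and orientations, using up-adjacency), $h^{\mathrm{down}}_{C_k}$ is defined identically on $\underline C_k$ using down-adjacency and $\omega^{\mathrm{down}},s^{\mathrm{down}}$, and $d^{\mathrm{down}}_{C_k}=k+1-\min_{\underline\sigma\in\underline C_k}\mathrm{LP}(\underline\sigma)\sum_{\underline\rho\subset\underline\sigma}\mathrm{LP}(\underline\rho)^{-1}$.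 *)

(* Defs.v *)
From HB Require Import structures.
From mathcomp Require Import boolp classical_sets reals.
From mathcomp Require Import all_boot all_order all_fingroup all_algebra.

Set Implicit Arguments.
Unset Strict Implicit.
Unset Printing Implicit Defensive.

Import Order.TTheory GRing.Theory Num.Theory.
Local Open Scope ring_scope.

(** * Simplicial complexes *)

Record simplicial_complex (V : finType) := SimplicialComplex {
  complex_faces :> {set {set V}};
  complex_nonempty : set0 \notin complex_faces;
  complex_singleton : forall x : V, [set x] \in complex_faces;
  complex_closed : forall A B : {set V}, A \in complex_faces ->
    B \subset A -> B != set0 -> B \in complex_faces
}.

Section Complex.
Variables (V : finType) (X : simplicial_complex V).
Implicit Types (A B : {set V}) (C Y : {set {set V}}).

Definition faces (k : nat) : {set {set V}} := [set A in X | #|A| == k.+1].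

Definition complex_dim : nat := \max_(A in X) #|A|.-1.

Definition leaf A : bool :=
  (A \in X) && [forall B in X, ~~ (A \proper B)].

(* The relation written [A ⊂ B] in the source: the inclusion of a [k]-face in
   a [(k+1)]-face. *)
Definition facet A B : bool :=
  [&& A \in X, B \in X, A \subset B & #|B| == #|A|.+1].

(* A chain of strict inclusions of subsets of [V] starting from [A] has at
   most [#|V|] steps, so that the fuel below is never exhausted on a face; the
   recursive equation is [LPE]. *)
Fixpoint LP_rec (n : nat) A : nat :=
  if n is n'.+1 then
    if leaf A then 1%N else (\sum_(B | facet A B) LP_rec n' B)%N
  else 1%N.

Definition LP A : nat := LP_rec #|V| A.

Lemma LPE A : A \in X ->
  LP A = if leaf A then 1%N else (\sum_(B | facet A B) LP B)%N.
Proof.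
have stable n m B : B \in X -> (#|V| <= n + #|B|)%N ->
    (#|V| <= m + #|B|)%N -> LP_rec n B = LP_rec m B.
  have leafT D : D \in X -> (#|V| <= #|D|)%N -> leaf D.
    move=> DX VD; rewrite /leaf DX; apply/forall_inP => E EX.
    apply/negP => /proper_card; rewrite ltnNge.
    by rewrite (leq_trans (max_card _)).
  elim: n m B => [|n IH] [|m] B BX //=.
  - by rewrite !add0n => /(leafT _ BX) ->.
  - by rewrite !add0n => _ /(leafT _ BX) ->.
  - move=> hn hm; case: ifP => // _; apply: eq_bigr => D.
    move=> /and4P[_ DX _ /eqP cD]; apply: IH => //.
      by rewrite cD addnS -addSn.
    by rewrite cD addnS -addSn.
move=> AX; have A0 : (0 < #|A|)%N.
  rewrite card_gt0; apply: contraTneq AX => ->.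
  exact: complex_nonempty.
rewrite /LP (@stable #|V| #|V|.+1) ?leq_addr //=.
by rewrite addSn leqW ?leq_addr.
Qed.

Definition up_adj (k : nat) A B : bool :=
  [&& A \in faces k, B \in faces k, A != B & A :|: B \in faces k.+1].

Definition down_adj (k : nat) A B : bool :=
  [&& (0 < k)%N, A \in faces k, B \in faces k, A != B
    & A :&: B \in faces k.-1].

Definition component (k : nat) (adj : rel {set V}) C : bool :=
  (C != set0) &&
  maxset (fun D : {set {set V}} => (D \subset faces k) &&
            [forall A in D, forall B in D, connect adj A B]) C.

Definition up_component (k : nat) C : bool := component k (up_adj k) C.

Definition down_component (k : nat) C : bool := component k (down_adj k) C.

Definition is_single_leaf C : Prop := exists2 A, leaf A & C = [set A].

(* Down-component in dimension [k] attached to an up-component [C] in dimension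
   [k - 1]. *)
Definition cofaces (k : nat) C : {set {set V}} :=
  [set A in faces k | [exists B in C, facet B A]].

Lemma up_adj_sym k : symmetric (up_adj k).
Proof. by move=> A B; rewrite /up_adj eq_sym setUC andbCA. Qed.

Lemma down_adj_sym k : symmetric (down_adj k).
Proof. by move=> A B; rewrite /down_adj eq_sym setIC (andbCA (A \in _)). Qed.

Lemma component_closed k (adj : rel {set V}) C A B : symmetric adj ->
  component k adj C -> A \in C -> adj A B -> B \in faces k -> B \in C.
Proof.
move=> sadj /andP[_ /maxsetP[/andP[Cf /forall_inP Cc] Cm]] AC AB Bf.
have csym : connect_sym adj by exact: sym_connect_sym.
have cAB D : D \in B |: C -> connect adj A D.
  case/setU1P => [->|DC]; first exact: connect1.
  by have /forall_inP := Cc _ AC; apply.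
rewrite -(Cm (B |: C)) ?setU11 ?subsetUr // subUset sub1set Bf Cf /=.
apply/forall_inP => D DC; apply/forall_inP => E EC.
by rewrite (connect_trans _ (cAB _ EC)) // csym cAB.
Qed.

Lemma facet_closed A B C k : up_component k C -> A \in C -> facet A B ->
  forall A', facet A' B -> A' \in C.
Proof.
move=> Cc AC AB A' A'B.
have [<-//|nAA'] := eqVneq A A'.
have /andP[_ /maxsetP[/andP[/subsetP Cf _] _]] := Cc.
have := Cf _ AC; rewrite inE => /andP[AX /eqP cA].
case/and4P: AB => _ BX sAB /eqP cB; case/and4P: A'B => A'X _ sA'B /eqP cB'.
have cA' : #|A'| = k.+1 by apply: succn_inj; rewrite -cB' cB cA.
have A'f : A' \in faces k by rewrite inE A'X cA' eqxx.
apply: (component_closed (@up_adj_sym k) Cc AC _ A'f).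
rewrite /up_adj (Cf _ AC) A'f nAA' /=.
suff -> : A :|: A' = B by rewrite inE BX cB cA eqxx.
apply/eqP; rewrite eqEcard subUset sAB sA'B /= cB cA.
have : A \proper A :|: A'.
  rewrite properEneq subsetUl andbT; apply: contra nAA' => /eqP E.
  have : A' \subset A by rewrite E subsetUr.
  by move=> s; rewrite eq_sym eqEcard s cA cA' leqnn.
by move/proper_card; rewrite cA.
Qed.

Lemma cofaces_down_component k C : (0 < k)%N -> up_component k.-1 C ->
  ~ is_single_leaf C -> down_component k (cofaces k C).
Proof.
case: k => // k _ /= Cc Cl.
have /andP[C0 /maxsetP[/andP[/subsetP Cf /forall_inP Cn] _]] := Cc.
have facetk A B : A \in C -> facet A B -> B \in cofaces k.+1 C.
  move=> AC AB; have := Cf _ AC; rewrite inE => /andP[_ /eqP cA].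
  rewrite inE; apply/andP; split; last by apply/existsP; exists A; rewrite AC.
  by case/and4P: AB => _ BX _ /eqP cB; rewrite inE BX cB cA eqxx.
have cofP B : B \in cofaces k.+1 C -> exists2 A, A \in C & facet A B.
  by rewrite inE => /andP[_ /existsP[A /andP[? ?]]]; exists A.
have up_facet A B : up_adj k A B -> facet A (A :|: B) && facet B (A :|: B).
  rewrite /up_adj !inE => /and4P[/andP[AX /eqP cA] /andP[BX /eqP cB] _].
  move=> /andP[UX /eqP cU].
  by rewrite /facet AX BX UX subsetUl subsetUr cA cB cU !eqxx.
have joined A B B' : A \in C -> facet A B -> facet A B' ->
    connect (down_adj k.+1) B B'.
  move=> AC AB AB'; have [->//|nBB'] := eqVneq B B'; apply: connect1.
  have Af := Cf _ AC.
  have := facetk _ _ AC AB; rewrite inE => /andP[Bf _].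
  have := facetk _ _ AC AB'; rewrite inE => /andP[B'f _].
  rewrite /down_adj Bf B'f nBB' /=; suff <- : A = B :&: B' by [].
  case/and4P: AB => _ _ sAB /eqP cB; case/and4P: AB' => _ _ sAB' /eqP cB'.
  apply/eqP; rewrite eqEcard subsetI sAB sAB' /= -ltnS -cB.
  apply: proper_card; rewrite properEneq subsetIl andbT.
  apply: contra nBB' => /eqP E; rewrite eqEcard cB cB' leqnn andbT.
  by rewrite -E subsetIr.
have cof0 : cofaces k.+1 C != set0.
  case/set0Pn: (C0) => A AC.
  have AX : A \in X by have := Cf _ AC; rewrite inE => /andP[].
  have : ~~ leaf A.
    apply/negP => lA; apply: Cl; exists A => //.
    apply/eqP; rewrite eqEsubset sub1set AC andbT; apply/subsetP => B BC.
    have /forall_inP /(_ _ BC) /connectP[[|D p] /= pth ->] := Cn _ AC.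
      by rewrite inE.
    case/andP: pth => /up_facet /andP[/and4P[_ UX sU /eqP cU] _] _.
    case/andP: lA => _ /forall_inP /(_ _ UX); rewrite properEcard sU cU.
    by rewrite ltnSn.
  rewrite /leaf AX /= => /forall_inPn[B BX]; rewrite negbK.
  case/properP => sAB [x xB xA]; apply/set0Pn; exists (x |: A).
  apply: (facetk _ _ AC); rewrite /facet AX subsetUr cardsU1 xA eqxx !andbT /=.
  apply: (complex_closed BX); first by rewrite subUset sub1set xB.
  by apply/set0Pn; exists x; rewrite setU11.
rewrite /down_component /component cof0; apply/maxsetP; split.
  apply/andP; split; first by apply/subsetP => A; rewrite inE => /andP[].
  apply/forall_inP => B /cofP[A AC AB]; apply/forall_inP => B' /cofP[A' A'C].
  have /forall_inP /(_ _ A'C) /connectP[p] := Cn _ AC.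
  elim: p A B AC AB => [|D p IH] A B AC AB /=.
    by move=> _ -> ; apply: joined.
  case/andP => AD pth lst A'B'; have /andP[f1 f2] := up_facet _ _ AD.
  have DC : D \in C by apply: facet_closed Cc AC f1 _ f2.
  by apply: connect_trans (IH D (A :|: D) DC f2 pth lst A'B'); apply: joined f1.
move=> D /andP[Df /forall_inP Dc] sD; apply/eqP.
rewrite eqEsubset sD andbT; apply/subsetP => B' B'D.
have [B Bc] := set0Pn _ cof0.
have /forall_inP /(_ _ B'D) /connectP[p] := Dc _ (subsetP sD _ Bc).
elim: p B Bc => [|E p IH] B Bc /=; first by move=> _ ->.
case/andP => BE pth; apply: (IH E) => //.
have [A AC AB] := cofP _ Bc.
case/and5P: BE => _ Bf Ef _; rewrite [_ \in faces _]inE => /andP[IX /eqP cI].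
move: Bf Ef; rewrite ![_ \in faces _]inE => /andP[BX /eqP cB] /andP[EX /eqP cE].
have f1 : facet (B :&: E) B by rewrite /facet IX BX subsetIl cB cI eqxx.
have f2 : facet (B :&: E) E by rewrite /facet IX EX subsetIr cE cI eqxx.
exact: facetk (facet_closed Cc AC AB f1) f2.
Qed.

Definition mu Y : nat := (\sum_(A in Y) LP A)%N.

End Complex.

(** * Oriented faces *)

Section OrientedFaces.
Variable V : finType.

(* A signed ordering [(e, t)] stands for the oriented face [t] if [e = false]
   and for its opposite if [e = true]. *)
Definition signed_ordering (k : nat) := (bool * k.+1.-tuple V)%type.

Definition reorder (k : nat) (t : k.+1.-tuple V) (p : 'S_k.+1) :
    k.+1.-tuple V := [tuple tnth t (p i) | i < k.+1].

(* Oriented [k]-faces are equivalence classes of signed orderings: a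
   permutation [p] of the vertices changes the sign by the parity of [p].  For
   [k >= 1] every class is of the form [ocls false t], and [ocls false t],
   [ocls false t'] agree iff [t], [t'] differ by an even permutation, so these
   are the orderings up to even permutations; for [k = 0] there are two
   classes [ocls false [tuple x]] and [ocls true [tuple x]] for each vertex
   [x], namely [x] and its opposite. *)
Definition ocls (k : nat) (e : bool) (t : k.+1.-tuple V) :
    {set signed_ordering k} :=
  [set (e (+) odd_perm p, reorder t p) | p : 'S_k.+1].

Definition oriented_over (k : nat) (A : {set V})
    (s : {set signed_ordering k}) : Prop :=
  exists (e : bool) (t : k.+1.-tuple V),
    [/\ uniq t, [set x in t] = A & s = ocls e t].

Definition omit (k : nat) (t : k.+2.-tuple V) (i : 'I_k.+2) : k.+1.-tuple V :=
  [tuple tnth t (lift i j) | j < k.+1].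

(* Only meaningful when [s] lies over a facet of the face under [tau]; the
   value does not depend on the ordering [t] representing [tau], see
   [incidenceE]. *)
Definition incidence (k : nat) (tau : {set signed_ordering k.+1})
    (s : {set signed_ordering k}) : int :=
  if [exists t : k.+2.-tuple V, exists i : 'I_k.+2,
        (tau == ocls false t) && (s == ocls (odd i) (omit t i))]
  then 1 else -1.

End OrientedFaces.

Section OrientedFacesTheory.
Variables (V : finType).

Lemma reorderM (k : nat) (t : k.+1.-tuple V) (p q : 'S_k.+1) :
  reorder (reorder t p) q = reorder t (q * p)%g.
Proof. by apply: eq_from_tnth => i; rewrite !tnth_mktuple permM. Qed.

Lemma ocls_reorder (k : nat) e (t : k.+1.-tuple V) (p : 'S_k.+1) :
  ocls e (reorder t p) = ocls (e (+) odd_perm p) t.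
Proof.
apply/setP => -[e' t']; apply/imsetP/imsetP => -[q _ [-> ->]].
  exists (q * p)%g => //; rewrite reorderM odd_permM; congr pair.
  by case: e; case: (odd_perm p); case: (odd_perm q).
exists (q * p^-1)%g => //; rewrite reorderM mulgKV odd_permM odd_permV.
by congr pair; case: e; case: (odd_perm p); case: (odd_perm q).
Qed.

Lemma ocls_eqP (k : nat) e e' (t t' : k.+1.-tuple V) :
  reflect (exists2 p : 'S_k.+1, t' = reorder t p & e' = e (+) odd_perm p)
          (ocls e t == ocls e' t').
Proof.
apply: (iffP eqP) => [E|[p -> ->]]; last first.
  by rewrite ocls_reorder addbK.
have : (e', t') \in ocls e' t'.
  apply/imsetP; exists 1%g => //; rewrite odd_perm1 addbF; congr pair.
  by apply: eq_from_tnth => i; rewrite tnth_mktuple perm1.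
by rewrite -E => /imsetP[p _ [-> ->]]; exists p.
Qed.

Lemma ocls_false (k : nat) e (t : k.+2.-tuple V) :
  exists t' : k.+2.-tuple V, ocls e t = ocls false t'.
Proof.
pose p : 'S_k.+2 := if e then tperm ord0 ord_max else 1%g.
exists (reorder t p); rewrite ocls_reorder /p.
by case: e {p}; rewrite ?odd_tperm ?odd_perm1.
Qed.

Lemma omit_reorder (k : nat) (t : k.+2.-tuple V) i j (p : 'S_k.+1) :
  omit (reorder t (lift_perm i j p)) i = reorder (omit t j) p.
Proof.
by apply: eq_from_tnth => m; rewrite !tnth_mktuple lift_perm_lift.
Qed.

Lemma incidenceE (k : nat) (t : k.+2.-tuple V) (e : bool) (i : 'I_k.+2) :
  uniq t ->
  incidence (ocls false t) (ocls e (omit t i)) = (-1) ^+ (e (+) odd i).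
Proof.
move=> /tuple_uniqP ut; rewrite /incidence; set b := [exists _, _].
suff -> : b = ~~ (e (+) odd i) by case: (e (+) odd i); rewrite ?expr1 ?expr0.
apply/idP/idP => [|ei]; last first.
  apply/existsP; exists t; apply/existsP; exists i.
  by rewrite eqxx -(_ : e = odd i) ?eqxx //; move: ei; rewrite negb_add => /eqP.
move=> /existsP[t' /existsP[i' /andP[/ocls_eqP[p -> p0] /ocls_eqP[q]]]].
rewrite -(omit_reorder t i' i q) => E oi'.
have El m : p (lift i' m) = lift_perm i' i q (lift i' m).
  by have := congr1 (fun s => tnth s m) E; rewrite !tnth_mktuple => /ut.
have Ep : p = lift_perm i' i q.
  apply/permP => j; case: (unliftP i' j) => [m ->|->]; first exact: El.
  have [//|ne] := eqVneq (p i') (lift_perm i' i q i').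
  pose j' := (p^-1 (lift_perm i' i q i'))%g.
  have pj' : p j' = lift_perm i' i q i' by rewrite permKV.
  case: (unliftP i' j') => [m jm|jm]; last by rewrite -pj' jm eqxx in ne.
  move: pj'; rewrite jm El => /perm_inj /eqP.
  by rewrite eq_sym (negPf (neq_lift _ _)).
move: p0; rewrite Ep odd_lift_perm oi' /=.
by case: (e); case: (odd i); case: (odd_perm q).
Qed.

End OrientedFacesTheory.

(* One oriented face over each face; dimensions are separated because the type
   of orderings depends on [k]. *)
Record orientation (V : finType) (X : simplicial_complex V) := Orientation {
  orient :> forall k : nat, {set V} -> {set signed_ordering V k};
  orientP : forall (k : nat) (A : {set V}), A \in faces X k ->
    oriented_over A (orient k A)
}.

(** * Laplacians *)

Section Laplacians.
Variables (R : realType) (V : finType) (X : simplicial_complex V).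
Variable O : orientation X.

Definition face_of (k : nat) (i : 'I_#|faces X k|) : {set V} := enum_val i.

Definition coboundary (k : nat) : 'M[R]_(#|faces X k.+1|, #|faces X k|) :=
  \matrix_(i, j)
    if face_of j \subset face_of i
    then (incidence (O k.+1 (face_of i)) (O k (face_of j)))%:~R else 0.

Definition weight (k : nat) (A : {set V}) : R := (LP X A)%:R / (k.+1)`!%:R.

(* [W_k ^ (1/2)] and [W_k ^ (-1/2)] *)
Definition W_sqrt (k : nat) : 'M[R]_#|faces X k| :=
  diag_mx (\row_i Num.sqrt (weight k (face_of i))).

Definition W_sqrtV (k : nat) : 'M[R]_#|faces X k| :=
  diag_mx (\row_i (Num.sqrt (weight k (face_of i)))^-1).

Definition delta (k : nat) : 'M[R]_(#|faces X k.+1|, #|faces X k|) :=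
  W_sqrt k.+1 *m coboundary k *m W_sqrtV k.

Definition Delta_up (k : nat) : 'M[R]_#|faces X k| :=
  (delta k)^T *m delta k.

(* [delta (k - 1) *m (delta (k - 1))^T]; the value at [k = 0] is irrelevant. *)
Definition Delta_down (k : nat) : 'M[R]_#|faces X k| :=
  match k with
  | 0%N => 0
  | k'.+1 => delta k' *m (delta k')^T
  end.

End Laplacians.

Definition principal_submx (R : Type) (n : nat) (M : 'M[R]_n) (S : {set 'I_n}) :
    'M[R]_#|S| :=
  mxsub (fun i : 'I_#|S| => enum_val i) (fun i : 'I_#|S| => enum_val i) M.

Definition restrict (R : Type) (V : finType) (X : simplicial_complex V)
    (k : nat) (M : 'M[R]_#|faces X k|) (C : {set {set V}}) :=
  principal_submx M [set i | face_of i \in C].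

(* The largest element of the (finite) set of eigenvalues. *)
Definition lambda_max (R : realType) (n : nat) (M : 'M[R]_n) : R :=
  sup [set a : R | eigenvalue M a]%classic.

(** * Cheeger constants *)

Lemma inf_finite (R : realType) (T : finType) (F : T -> R) (E : R -> Prop) :
  (exists r, E r) -> (forall r, E r -> exists x, F x = r) ->
  E (inf E) /\ forall r, E r -> inf E <= r.
Proof.
move=> [r0 Er0] EF; have [x0 Fx0] := EF _ Er0.
have P0 : `[< E (F x0) >] by apply/asboolP; rewrite Fx0.
case: (@arg_minP _ R T x0 (fun x => `[< E (F x) >]) F P0) => m /asboolP Em mP.
have lb r : E r -> F m <= r.
  move=> Er; have [x Fx] := EF _ Er.
  by rewrite -Fx mP //; apply/asboolP; rewrite Fx.
have -> : inf E = F m; last by [].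
apply/le_anti/andP; split; first by apply: ge_inf Em; exists (F m).
by apply: lb_le_inf; [exists r0 | exact: lb].
Qed.

Section Cheeger.
Variables (R : realType) (V : finType) (X : simplicial_complex V).
Implicit Types (A B : {set V}) (C Y : {set {set V}}) (O : orientation X).

(* These signs do not depend on the orientation of [A :|: B], resp.
   [A :&: B], so the one given by [O] is used. *)
Definition s_up (k : nat) O A B : int :=
  incidence (O k.+1 (A :|: B)) (O k A) * incidence (O k.+1 (A :|: B)) (O k B).

Definition s_down (k : nat) O A B : int :=
  match k with
  | 0%N => 1
  | k'.+1 => incidence (O k'.+1 A) (O k' (A :&: B)) *
             incidence (O k'.+1 B) (O k' (A :&: B))
  end.

Definition omega_up A B : R := (LP X (A :|: B))%:R.

Definition omega_down A B : R :=
  (LP X A)%:R * (LP X B)%:R / (LP X (A :&: B))%:R.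

Section Generic.
Variables (adj : rel {set V}) (omega : {set V} -> {set V} -> R).
Variable (s : orientation X -> {set V} -> {set V} -> int).

Definition cut Y C : R :=
  \sum_(A in Y) \sum_(B in C :\: Y | adj A B) omega A B.

Definition negative_part Y O : R :=
  \sum_(A in Y) \sum_(B in Y | adj A B && (s O A B == -1)) omega A B.

Definition cheeger_ratio C Y O : R :=
  (cut Y C + negative_part Y O) / (mu X Y)%:R.

(* The infimum is over finitely many values, hence a minimum: see
   [cheegerP]. *)
Definition cheeger C : R :=
  inf [set r : R | exists (Y : {set {set V}}) (O : orientation X),
         [/\ Y != set0, Y \subset C & r = cheeger_ratio C Y O]]%classic.

Lemma cheegerP C (O0 : orientation X) : C != set0 ->
  (exists (Y : {set {set V}}) (O : orientation X),
     [/\ Y != set0, Y \subset C & cheeger C = cheeger_ratio C Y O]) /\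
  forall Y O, Y != set0 -> Y \subset C -> cheeger C <= cheeger_ratio C Y O.
Proof.
move=> C0; rewrite /cheeger; set E := (X in inf X).
pose F (x : {set {set V}} * {set ({set V} * {set V})}) : R :=
  (cut x.1 C + \sum_(A in x.1)
     \sum_(B in x.1 | adj A B && ((A, B) \in x.2)) omega A B) / (mu X x.1)%:R.
have [||min lb] := @inf_finite R _ F E.
- by exists (cheeger_ratio C C O0), C, O0.
- move=> r [Y [O [_ _ ->]]]; exists (Y, [set p | s O p.1 p.2 == -1]).
  rewrite /F /cheeger_ratio /negative_part /=; congr ((_ + _) / _).
  by apply: eq_bigr => A _; apply: eq_bigl => B; rewrite inE.
by split=> // Y O Y0 YC; apply: lb; exists Y, O.
Qed.

End Generic.

Definition h_up (k : nat) C : R := cheeger (up_adj X k) omega_up (s_up k) C.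

Definition h_down (k : nat) C : R :=
  cheeger (down_adj X k) omega_down (s_down k) C.

Definition d_down (k : nat) C : R :=
  k.+1%:R -
  inf [set r : R | exists2 A : {set V}, A \in C &
         r = (LP X A)%:R * \sum_(B | facet X B A) ((LP X B)%:R)^-1]%classic.

End Cheeger.

(* Main.v *)
(** Up to the factor [k + 1], both [1 - Delta_up] and [1 - Delta_down] are
    normalized Laplacians of signed graphs, whose vertices are the [k-1]-faces,
    resp. [k]-faces, of the component: writing a vector as [sqrt W] times a
    function [f] on faces, the weighted Lagrange identity applied around each
    [k]-face, resp. each [k-1]-face, turns [(k + 1) (|v|^2 - <v, Delta v>)] into
    [1/2 sum omega (f A - s f B)^2].  The relation [LP A = sum LP B] over the
    cofaces of [A] makes the vertex degrees equal to [k LP], resp. at most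
    [d_down LP].  The inequalities are then the Cheeger inequalities for signed
    graphs: the indicator of an optimal set gives the upper bound, and a layer
    decomposition of the square of an eigenfunction, made nonnegative by
    reversing orientations, gives the lower one.  The two largest eigenvalues
    agree because the restrictions are [D^T D] and [D D^T] for one matrix [D]. *)

Require Import Defs.
From HB Require Import structures.
From mathcomp Require Import boolp classical_sets reals.
From mathcomp Require Import all_boot all_order all_fingroup all_algebra.
From mathcomp Require Import ring lra.

Set Implicit Arguments.
Unset Strict Implicit.
Unset Printing Implicit Defensive.

Import Order.TTheory GRing.Theory Num.Theory.
Local Open Scope ring_scope.

(** * Rayleigh quotients *)

Section Rayleigh.
Variable R : realType.

Definition normsq (n : nat) (v : 'rV[R]_n) : R := \sum_i v 0 i ^+ 2.

Definition quad (n : nat) (M : 'M[R]_n) (v : 'rV[R]_n) : R :=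
  (v *m M *m v^T) 0 0.

Lemma normsqE n (v : 'rV[R]_n) : normsq v = (v *m v^T) 0 0.
Proof. by rewrite mxE; apply: eq_bigr => i _; rewrite mxE expr2. Qed.

Lemma normsq_ge0 n (v : 'rV[R]_n) : 0 <= normsq v.
Proof. by apply: sumr_ge0 => i _; apply: sqr_ge0. Qed.

Lemma normsq_gt0 n (v : 'rV[R]_n) : v != 0 -> 0 < normsq v.
Proof.
move=> v0; rewrite lt0r normsq_ge0 andbT; apply: contra v0.
rewrite psumr_eq0 => [/allP v0|i _]; last exact: sqr_ge0.
apply/eqP/rowP => i; have := v0 i (mem_index_enum _).
by rewrite /= sqrf_eq0 mxE => /eqP.
Qed.

Lemma normsq_const1_gt0 n : (0 < n)%N -> 0 < normsq (const_mx 1 : 'rV[R]_n).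
Proof.
case: n => // n _; apply: normsq_gt0; apply/eqP => /rowP /(_ ord0).
by rewrite !mxE => /eqP; rewrite oner_eq0.
Qed.

Lemma quad_mulmx_tr n p (D : 'M[R]_(n, p)) v :
  quad (D *m D^T) v = normsq (v *m D).
Proof. by rewrite normsqE /quad trmx_mul !mulmxA. Qed.

Lemma quad_scalar_sub n (M : 'M[R]_n) a v :
  quad (a%:M - M) v = a * normsq v - quad M v.
Proof.
by rewrite normsqE /quad mulmxBr mulmxBl mul_mx_scalar -scalemxAl !mxE.
Qed.

Lemma quad_le n (M : 'M[R]_n) : exists2 c, 0 < c &
  forall v, quad M v <= c * normsq v.
Proof.
(* The summand 1 keeps the constant positive even for the zero matrix. *)
exists (1 + \sum_i \sum_j `|M j i|).
  by apply: ltr_pwDl => //; do 2! (apply: sumr_ge0 => ? _).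
move=> v; apply: (@le_trans _ _ ((\sum_i \sum_j `|M j i|) * normsq v)).
  rewrite /quad mxE mulr_suml; apply: ler_sum => i _.
  rewrite !mxE !mulr_suml; apply: ler_sum => j _.
  have vle l : v 0 l ^+ 2 <= normsq v.
    rewrite /normsq (bigD1 l) //= lerDl.
    by apply: sumr_ge0 => ? _; apply: sqr_ge0.
  apply: (le_trans (ler_norm _)).
  rewrite (mulrC (v 0 j)) -mulrA normrM ler_wpM2l //.
  by rewrite ler_norml; apply/andP; split; have := vle i; have := vle j; nra.
by rewrite ler_wpM2r ?normsq_ge0 // lerDr.
Qed.

(* Expanding [0 <= quad P (v - t v P^-1)] and choosing [t] bounds the form
   from below in terms of an upper bound of the form of [P^-1]. *)
Lemma psd_unit_lower n (P : 'M[R]_n) : P^T = P -> P \in unitmx ->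
  (forall v, 0 <= quad P v) ->
  exists2 e, 0 < e & forall v, e * normsq v <= quad P v.
Proof.
move=> sP uP pP; have [c c0 cP] := quad_le (invmx P).
exists c^-1; first by rewrite invr_gt0.
move=> v; set u := v *m invmx P.
have uPv : u *m P = v by rewrite mulmxKV.
have sPu : P *m u^T = v^T by rewrite -{1}sP -trmx_mul uPv.
have E : quad P (v - c^-1 *: u) =
    quad P v - 2 * c^-1 * normsq v + c^-1 ^+ 2 * quad (invmx P) v.
  have vu : (v *m u^T) 0 0 = quad (invmx P) v.
    by rewrite /quad -/u -(trmxK v) -trmx_mul trmxK mxE.
  rewrite normsqE -vu /quad !mulmxBl -!scalemxAl uPv linearB linearZ /=.
  rewrite !mulmxBr -!scalemxAr -!mulmxA sPu !mulmxA.
  by rewrite !mxE; ring.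
have := pP (v - c^-1 *: u); rewrite E => H.
have H2 : c^-1 ^+ 2 * quad (invmx P) v <= c^-1 ^+ 2 * (c * normsq v).
  by rewrite ler_wpM2l ?sqr_ge0.
have E2 : c^-1 ^+ 2 * (c * normsq v) = c^-1 * normsq v.
  by rewrite expr2 -!mulrA (mulKf (lt0r_neq0 c0)).
by move: H H2; rewrite E2; lra.
Qed.

(** No compactness is used: if the supremum [sup E] of the Rayleigh quotients were not an
    eigenvalue, [(sup E)%:M - M] would be positive semidefinite and invertible, hence bounded below
    by some [e > 0], and [sup E - e] would bound the quotients too. *)
Lemma lambda_maxP n (M : 'M[R]_n) : (0 < n)%N -> M^T = M ->
  (forall v, quad M v <= lambda_max M * normsq v) /\
  (exists2 v : 'rV_n, v != 0 & v *m M = lambda_max M *: v).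
Proof.
move=> n0 sM; pose E : set R :=
  [set r | exists2 v : 'rV_n, 0 < normsq v & quad M v = r * normsq v]%classic.
have [c c0 cP] := quad_le M.
have E0 : (E !=set0)%classic.
  exists (quad M (const_mx 1) / normsq (const_mx 1 : 'rV[R]_n)).
  exists (const_mx 1); rewrite ?normsq_const1_gt0 // divfK //.
  by rewrite lt0r_neq0 ?normsq_const1_gt0.
have Eub : has_ubound E.
  exists c => r [v v0 rE].
  by have := cP v; rewrite rE ler_pM2r.
have ray v : quad M v <= sup E * normsq v.
  have [->|v0] := eqVneq v 0.
    by rewrite /quad !mul0mx mxE normsqE mul0mx mxE mulr0.
  have nv := normsq_gt0 v0; rewrite -ler_pdivrMr //.
  apply: ub_le_sup => //; exists v => //; by rewrite divfK // lt0r_neq0.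
have [w w0 wE] : exists2 v : 'rV_n, v != 0 & v *m M = sup E *: v.
  suff /eigenvalueP[v] : eigenvalue M (sup E) by exists v.
  apply: contraT => nE.
  have uP : (sup E)%:M - M \in unitmx.
    rewrite -row_free_unit -kermx_eq0.
    move: nE; rewrite /eigenvalue negbK /eigenspace.
    by rewrite !kermx_eq0 !row_free_unit -opprB -scaleN1r unitmxZ ?unitrN1.
  have [|v|e e0 eP] := psd_unit_lower _ uP.
  - by rewrite linearB /= tr_scalar_mx sM.
  - by rewrite quad_scalar_sub subr_ge0.
  suff : sup E <= sup E - e by move: e0; lra.
  apply: ge_sup => // r [v v0 rE].
  have := eP v; rewrite quad_scalar_sub rE -mulrBl ler_pM2r //; lra.
suff -> : lambda_max M = sup E by split=> //; exists w.
have ub : ubound [set a : R | eigenvalue M a]%classic (sup E).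
  move=> a /= /eigenvalueP[v va v0].
  have := ray v; rewrite /quad va -scalemxAl mxE -normsqE.
  by rewrite ler_pM2r // normsq_gt0.
apply/le_anti/andP; split.
  by apply: ge_sup => //; exists (sup E); apply/eigenvalueP; exists w.
by apply: ub_le_sup; [exists (sup E) | apply/eigenvalueP; exists w].
Qed.

(** A top eigenvector [v] of [D *m D^T] is carried to [v *m D], which [D^T *m D] multiplies by the
    same eigenvalue. If [v *m D] vanishes, the eigenvalue is 0 and positive semidefiniteness of
    [D^T *m D] suffices. *)
Lemma lambda_max_mulmx_le m n (D : 'M[R]_(m, n)) : (0 < m)%N -> (0 < n)%N ->
  lambda_max (D *m D^T) <= lambda_max (D^T *m D).
Proof.
move=> m0 n0; have sym p q (B : 'M[R]_(p, q)) : (B *m B^T)^T = B *m B^T.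
  by rewrite trmx_mul trmxK.
have [_ [v v0 vE]] := lambda_maxP m0 (sym _ _ D).
have [ray _] := lambda_maxP n0 (sym _ _ D^T).
rewrite trmxK in ray; set l := lambda_max (D *m D^T) in vE *.
have [w0|w0] := eqVneq (v *m D) 0.
  have /eqP : l *: v = 0 by rewrite -vE mulmxA w0 mul0mx.
  rewrite scaler_eq0 (negPf v0) orbF => /eqP ->.
  rewrite -(pmulr_lge0 _ (normsq_const1_gt0 n0)).
  apply: le_trans (ray _).
  by rewrite -{2}(trmxK D) quad_mulmx_tr normsq_ge0.
have := ray (v *m D).
have -> : quad (D^T *m D) (v *m D) = l * normsq (v *m D).
  by rewrite /quad mulmxA -(mulmxA v) vE -!scalemxAl mxE normsqE.
by rewrite ler_pM2r // normsq_gt0.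
Qed.

Lemma lambda_max_mulmxC m n (D : 'M[R]_(m, n)) : (0 < m)%N -> (0 < n)%N ->
  lambda_max (D *m D^T) = lambda_max (D^T *m D).
Proof.
move=> m0 n0; apply/le_anti; rewrite lambda_max_mulmx_le //=.
by have := lambda_max_mulmx_le D^T n0 m0; rewrite trmxK.
Qed.

End Rayleigh.

(** * Cheeger inequalities for signed graphs *)

Section SignedGraph.
Variables (R : realType) (T : finType) (C : {set T}).
Variables (adj : rel T) (w : T -> T -> R).
Hypothesis adjC : symmetric adj.
Hypothesis wC : forall x y, w x y = w y x.
Hypothesis w_ge0 : forall x y, 0 <= w x y.
Implicit Types (sg : rel T) (f g : T -> R) (Y : {set T}).

(** [sg x y] true encodes the sign -1. The sum is over ordered pairs, so each edge counts twice. *)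
Definition energy sg f : R :=
  \sum_(x in C) \sum_(y in C | adj x y)
     w x y * (f x - (-1) ^+ sg x y * f y) ^+ 2.

Lemma energy_ge0 sg f : 0 <= energy sg f.
Proof.
apply: sumr_ge0 => x _; apply: sumr_ge0 => y _.
by rewrite mulr_ge0 ?sqr_ge0.
Qed.

(** For nonnegative [x] and [y] this is the absolute value of [x - (-1) ^+ b * y]. *)
Definition phi (b : bool) (x y : R) : R := if b then x + y else `|x - y|.

Definition variation sg g : R :=
  \sum_(x in C) \sum_(y in C | adj x y) w x y * phi (sg x y) (g x) (g y).

Definition boundary sg Y : R :=
  \sum_(x in Y) \sum_(y in C :\: Y | adj x y) w x y +
  \sum_(x in Y) \sum_(y in Y | adj x y && sg x y) w x y.

(** A cut edge contributes 1 in each of its two orders. Inside [Y] a negative ordered pair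
    contributes 1 + 1 and a positive one 0. *)
Lemma variation_indicator sg Y : Y \subset C ->
  variation sg (fun x => (x \in Y)%:R) = 2 * boundary sg Y.
Proof.
move=> /subsetP YC; rewrite /variation /boundary mulrDr.
rewrite !pair_big_dep /=; set c := (X in 2 * X + _).
(* One of the two copies of the cut sum is reindexed by exchanging the endpoints, so that all sums
   can be compared pair by pair. *)
have cC : c = \sum_(p : T * T | (p.2 \in Y) && ((p.1 \in C :\: Y) && adj p.2 p.1))
    w p.2 p.1.
  pose swap (p : T * T) := (p.2, p.1).
  have swapK : involutive swap by case.
  by rewrite /c (reindex_inj (inv_inj swapK)).
rewrite mulr_natl mulr2n {2}cC /c mulr_sumr.
rewrite [LHS]big_mkcond [X in X + _ + _]big_mkcond [X in _ + X + _]big_mkcond.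
rewrite [X in _ + X]big_mkcond -!big_split /=.
apply: eq_bigr => -[x y] _ /=; rewrite (adjC y x) (wC y x) !inE.
have := YC y; have := YC x; rewrite /phi; set W := w x y.
case: (x \in Y) => [/(_ isT)->|_]; case: (y \in Y) => [/(_ isT)->|_].
all: case: (x \in C); case: (y \in C); case: (adj x y); case: (sg x y) => //=.
all: rewrite ?subrr ?subr0 ?sub0r ?normrN ?normr0 ?normr1; lra.
Qed.

Lemma variation_ge0 sg g : (forall x, 0 <= g x) -> 0 <= variation sg g.
Proof.
move=> g0; apply: sumr_ge0 => x _; apply: sumr_ge0 => y _.
by rewrite mulr_ge0 // /phi; case: sg; rewrite // addr_ge0.
Qed.

(* Layer-cake decomposition: peel off the minimal positive value of [g] on its
   support and proceed by induction on the size of the support. *)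
Lemma coarea sg (m : T -> R) (h : R) :
  (forall Y, Y != finset.set0 -> Y \subset C ->
     h * \sum_(x in Y) m x <= boundary sg Y) ->
  forall g, (forall x, 0 <= g x) ->
    2 * h * \sum_(x in C) m x * g x <= variation sg g.
Proof.
move=> hY g; have [n] := ubnP #|[set x in C | 0 < g x]|.
elim: n g => // n IH g; set Y := [set x in C | 0 < g x] => cY g0.
have YC : Y \subset C by apply/subsetP => x; rewrite inE => /andP[].
have gN x : x \in C -> x \notin Y -> g x = 0.
  by move=> xC; rewrite inE xC lt0r g0 andbT negbK => /eqP.
have [Y0|/set0Pn[x0 x0Y]] := eqVneq Y finset.set0.
  rewrite big1 ?mulr0 ?variation_ge0 // => x xC.
  by rewrite gN ?mulr0 // Y0 inE.
have [x1 x1Y x1min] := @arg_minP _ _ _ x0 (mem Y) g x0Y.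
set a := g x1 in x1min; have {}x1Y : x1 \in Y := x1Y.
have {}x1min x : x \in Y -> a <= g x := @x1min x.
have a0 : 0 < a by move: x1Y; rewrite inE => /andP[].
pose g' x := if x \in Y then g x - a else g x.
have g'0 x : 0 <= g' x.
  by rewrite /g'; case: ifP => // /x1min; rewrite subr_ge0.
have gE x : g x = g' x + a * (x \in Y)%:R.
  by rewrite /g'; case: ifP => _; rewrite ?mulr1 ?mulr0 ?addr0 ?subrK.
have E1 : \sum_(x in C) m x * g x =
    \sum_(x in C) m x * g' x + a * \sum_(x in Y) m x.
  under eq_bigr => x _ do rewrite gE mulrDr.
  rewrite big_split /=; congr (_ + _).
  rewrite mulr_sumr [LHS]big_mkcond [RHS]big_mkcond; apply: eq_bigr => x _ /=.
  have := subsetP YC x; case: (x \in Y) => [/(_ isT) ->|_]; first by rewrite mulr1 mulrC.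
  by case: ifP; rewrite // !mulr0.
(* Peeling is additive for [phi]: differences inside [Y] are unchanged and sums there drop by
   [2 * a]. On an edge leaving [Y] the outer value is 0, so [phi] is the inner value and drops by
   [a]. *)
have E2 : variation sg g =
    variation sg g' + a * variation sg (fun x => (x \in Y)%:R).
  rewrite /variation mulr_sumr -big_split; apply: eq_bigr => x xC /=.
  rewrite mulr_sumr -big_split; apply: eq_bigr => y /andP[yC _] /=.
  rewrite mulrCA -mulrDr; congr (_ * _); rewrite /phi /g'.
  have := gN x xC; have := gN y yC; have := x1min x; have := x1min y.
  have := g0 x; have := g0 y.
  case: (x \in Y) => /=; case: (y \in Y) => /=; case: (sg x y) => /=; try lra.
  - move=> *; rewrite subrr normr0 mulr0 addr0; congr `|_|; lra.
  - move=> _ gx _ /(_ isT) h1 /(_ isT) -> _; rewrite !subr0 normr1.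
    by rewrite !ger0_norm //; lra.
  - move=> gy _ /(_ isT) h1 _ _ /(_ isT) ->; rewrite !sub0r !normrN normr1.
    by rewrite !ger0_norm //; lra.
  - by move=> *; rewrite subrr normr0; lra.
(* The minimizer [x1] leaves the support, and no point enters it. *)
have cY' : (#|[set x in C | 0 < g' x]%R| < n)%N.
  rewrite -ltnS; apply: leq_trans cY; rewrite ltnS; apply: proper_card.
  apply/properP; split; last first.
    by exists x1; rewrite // inE /g' x1Y subrr ltxx andbF.
  apply/subsetP => x; rewrite !inE => /andP[xC]; rewrite xC /g'; case: ifP => //.
  by rewrite inE => /andP[].
have := IH g' cY' g'0; rewrite E1 E2 variation_indicator //.
have Y0 : Y != finset.set0 by apply/set0Pn; exists x0.
have := ler_wpM2l (ltW a0) (hY Y Y0 YC); lra.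
Qed.

(** [coarea] for the square of [f] gives [2 * h * S <= variation]. Cauchy-Schwarz, in the additive
    form [E], bounds the variation by the energy and [P], and the degree bound gives
    [P <= 4 * d * S]. The multiple of [S] coming from [P] absorbs half of the left side. *)
Lemma cheeger_inequality sg (m : T -> R) (h d : R) f : 0 <= h -> 0 < d ->
  (forall x, x \in C -> \sum_(y in C | adj x y) w x y <= d * m x) ->
  (forall Y, Y != finset.set0 -> Y \subset C ->
     h * \sum_(x in Y) m x <= boundary sg Y) ->
  (forall x, 0 <= f x) ->
  h ^+ 2 * \sum_(x in C) m x * f x ^+ 2 <= d * energy sg f.
Proof.
move=> h0 d0 deg hY f0.
set S := \sum_(x in C) _; pose P := \sum_(x in C) \sum_(y in C | adj x y)
  w x y * (f x + f y) ^+ 2.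
have PS : P <= 4 * d * S.
  pose A := \sum_(x in C) \sum_(y in C | adj x y) w x y * f x ^+ 2.
  have AS : A <= d * S.
    rewrite mulr_sumr; apply: ler_sum => x xC; rewrite -mulr_suml.
    by rewrite mulrA ler_wpM2r ?sqr_ge0 // deg.
  have AE : A = \sum_(x in C) \sum_(y in C | adj x y) w x y * f y ^+ 2.
    rewrite (exchange_big_dep (mem C)) /=; last by move=> x y _ /andP[].
    apply: eq_bigr => x xC; apply: eq_big => [y|y _]; last by rewrite wC.
    by rewrite xC adjC.
  suff : P <= 2 * A + 2 * A by lra.
  rewrite {2}AE /P !mulr_sumr -big_split; apply: ler_sum => x _ /=.
  rewrite !mulr_sumr -big_split; apply: ler_sum => y _ /=.
  by have := w_ge0 x y; have := sqr_ge0 (f x - f y); nra.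
(* On a positive edge this is [2ab <= a^2 + b^2] for [a = 2d|f x - f y|] and [b = h(f x + f y)]. On
   a negative edge it follows from [4dh <= 4d^2 + h^2] and
   [f x ^+ 2 + f y ^+ 2 <= (f x + f y) ^+ 2]. *)
have E : 4 * d * h * variation sg (fun x => f x ^+ 2) <=
    4 * d ^+ 2 * energy sg f + h ^+ 2 * P.
  rewrite /variation /energy /P !mulr_sumr -big_split; apply: ler_sum => x _ /=.
  rewrite !mulr_sumr -big_split; apply: ler_sum => y _ /=.
  rewrite !(mulrCA _ (w x y)) -mulrDr ler_wpM2l // /phi.
  have fx := f0 x; have fy := f0 y; case: (sg x y) => /=.
    rewrite expr1 mulN1r opprK.
    have dh : 0 <= d * h by rewrite mulr_ge0 // ltW.
    have := sqr_ge0 ((2 * d - h) * (f x + f y)).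
    have := mulr_ge0 dh (mulr_ge0 fx fy); nra.
  rewrite expr0 mul1r -(ger0_norm (_ : 0 <= 4 * d * h)); last first.
    by rewrite !mulr_ge0 // ltW.
  rewrite -normrM ler_norml; apply/andP; split.
    have := sqr_ge0 (2 * d * (f x - f y) + h * (f x + f y)); lra.
  have := sqr_ge0 (2 * d * (f x - f y) - h * (f x + f y)); lra.
have := coarea hY (fun x => sqr_ge0 (f x)); rewrite -/S => co.
have dh : 0 <= 4 * d * h by rewrite !mulr_ge0 // ltW.
have := ler_wpM2l dh co; have := ler_wpM2l (sqr_ge0 h) PS => H1 H2.
rewrite -(ler_pM2l d0); lra.
Qed.

(** On values 0 and 1 each squared difference is at most twice [phi], with equality for a negative
    pair inside [Y], where it is 4. *)
Lemma energy_indicator_le sg Y : Y \subset C ->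
  energy sg (fun x => (x \in Y)%:R) <= 4 * boundary sg Y.
Proof.
move=> YC; rewrite (_ : 4 = 2 * 2 :> R); last ring.
rewrite -mulrA -variation_indicator // mulr_sumr; apply: ler_sum => x _.
rewrite mulr_sumr; apply: ler_sum => y _; rewrite [leRHS]mulrCA ler_wpM2l // /phi.
case: (x \in Y); case: (y \in Y); case: (sg x y);
  rewrite /= ?expr0 ?expr1 ?subrr ?subr0 ?sub0r ?normrN ?normr0 ?normr1; lra.
Qed.

(** Invariance under switching of a signed graph: changing the sign of [f] at a vertex is
    compensated by changing the signs of its edges. *)
Lemma energy_switch sg sg' (b : T -> bool) f :
  {in C &, forall x y, adj x y -> sg' x y = sg x y (+) b x (+) b y} ->
  energy sg' (fun x => (-1) ^+ b x * f x) = energy sg f.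
Proof.
move=> E; apply: eq_bigr => x xC; apply: eq_bigr => y /andP[yC xy].
congr (_ * _); rewrite E //.
by case: (sg x y); case: (b x); case: (b y); rewrite /= ?expr0 ?expr1; ring.
Qed.

End SignedGraph.

(** * Cheeger constants of a component against its signed energy *)

Section CheegerConstant.
Variables (R : realType) (V : finType) (X : simplicial_complex V).
Variables (C : {set {set V}}) (adj : rel {set V}).
Variables (omega : {set V} -> {set V} -> R).
Variable (s : orientation X -> {set V} -> {set V} -> int).
Hypothesis adjC : symmetric adj.
Hypothesis omegaC : forall A B, omega A B = omega B A.
Hypothesis omega_ge0 : forall A B, 0 <= omega A B.
Hypothesis C0 : C != finset.set0.
Hypothesis LP_gt0 : forall A, A \in C -> (0 < LP X A)%N.

Definition neg_sign O A B : bool := s O A B == -1.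

(** Switching equivalence of the signed graphs of two orientations; [b] marks the reversed faces. *)
Definition switched O O' (b : {set V} -> bool) :=
  {in C &, forall A B, adj A B ->
    neg_sign O' A B = neg_sign O A B (+) b A (+) b B}.

Hypothesis switch_orientation : forall O b, exists O', switched O O' b.
Hypothesis switch_between : forall O O', exists b, switched O O' b.

Lemma sqr_signM (b : bool) (x : R) : ((-1) ^+ b * x) ^+ 2 = x ^+ 2.
Proof. by rewrite exprMn sqrr_sign mul1r. Qed.

Let E O f := energy C adj omega (neg_sign O) f.
Let h := cheeger adj omega s C.

Lemma muR Y : (mu X Y)%:R = \sum_(A in Y) (LP X A)%:R :> R.
Proof. by rewrite natr_sum. Qed.

Lemma mu_gt0 Y : Y != finset.set0 -> Y \subset C -> 0 < (mu X Y)%:R :> R.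
Proof.
move=> /set0Pn[A AY] /subsetP YC; rewrite ltr0n /mu (bigD1 A) //=.
by rewrite addn_gt0 LP_gt0 ?YC.
Qed.

Lemma cheeger_ge0 (O : orientation X) : 0 <= h.
Proof.
have [[Y [O' [Y0 YC hE]]] _] := cheegerP adj omega s O C0.
rewrite /h hE /cheeger_ratio divr_ge0 // addr_ge0 //;
  by apply: sumr_ge0 => A _; apply: sumr_ge0.
Qed.

(** Reversing the faces where [f] is negative replaces [f] by its absolute value at equal energy.
    Since the Cheeger constant minimizes over orientations, its bound applies to the reversed
    one. *)
Lemma cheeger_le_energy O f (d : R) : 0 < d ->
  (forall A, A \in C -> \sum_(B in C | adj A B) omega A B <= d * (LP X A)%:R) ->
  h ^+ 2 * \sum_(A in C) (LP X A)%:R * f A ^+ 2 <= d * E O f.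
Proof.
move=> d0 deg; have [O' sw] := switch_orientation O (fun A => f A < 0).
rewrite /E -(energy_switch _ _ sw).
under eq_bigr => A _ do rewrite -(sqr_signM (f A < 0) (f A)).
apply: cheeger_inequality => //.
- exact: cheeger_ge0.
- move=> Y Y0 YC; have [_ /(_ Y O' Y0 YC)] := cheegerP adj omega s O C0.
  by rewrite /cheeger_ratio ler_pdivlMr ?mu_gt0 // muR.
- move=> A /=; rewrite -normrEsign //.
Qed.

(** The test function is the indicator of an optimal set, transported by signs from the optimal
    orientation to [O]. *)
Lemma energy_le_cheeger O : exists f,
  0 < \sum_(A in C) (LP X A)%:R * f A ^+ 2 /\
  E O f <= 4 * h * \sum_(A in C) (LP X A)%:R * f A ^+ 2.
Proof.
have [[Y [O' [Y0 YC hE]]] _] := cheegerP adj omega s O C0.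
have [b sw] := switch_between O' O.
exists (fun A => (-1) ^+ b A * (A \in Y)%:R).
rewrite /E (energy_switch _ _ sw).
under eq_bigr => A _ do rewrite sqr_signM.
have -> : \sum_(A in C) (LP X A)%:R * (A \in Y)%:R ^+ 2 = (mu X Y)%:R :> R.
  rewrite muR [LHS]big_mkcond [RHS]big_mkcond; apply: eq_bigr => A _.
  have := subsetP YC A; case: (A \in Y) => [/(_ isT) ->|_].
    by rewrite expr1n mulr1.
  by rewrite expr0n mulr0; case: ifP.
split; first exact: mu_gt0.
have -> : 4 * h * (mu X Y)%:R = 4 * boundary C adj omega (neg_sign O') Y.
  by rewrite /h hE /cheeger_ratio -mulrA divfK // lt0r_neq0 ?mu_gt0.
exact: energy_indicator_le.
Qed.

End CheegerConstant.

(** * Reversal of orientations *)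

Section Switching.
Variable V : finType.

(** Opposite orientation when [b] is true. Acting on the sign bit covers dimension 0 as well, where
    no permutation is odd. *)
Definition flip (k : nat) (b : bool) (s : {set signed_ordering V k}) :
    {set signed_ordering V k} :=
  [set (b (+) x.1, x.2) | x in s].

Lemma flip_ocls k b e (t : k.+1.-tuple V) : flip b (ocls e t) = ocls (b (+) e) t.
Proof.
apply/setP => -[e' t']; apply/imsetP/imsetP => [[x /imsetP[p _ ->]]|[p _]] [-> ->].
  by exists p; rewrite /= ?addbA.
exists (e (+) odd_perm p, reorder t p); last by rewrite /= addbA.
by apply/imsetP; exists p.
Qed.

(** The sign of the larger face is absorbed into an odd reordering of [t], which reduces to
    [incidenceE]. *)
Lemma incidence_ocls k (t : k.+2.-tuple V) e e' i : uniq t ->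
  incidence (ocls e t) (ocls e' (omit t i)) = (-1) ^+ (e (+) e' (+) odd i).
Proof.
move=> ut; case: e => /=; last exact: incidenceE.
(* Moving the omitted vertex from position [i] to a position [j] of the other parity is an odd
   permutation that leaves the remaining ordering intact. *)
have [j oj] : exists j : 'I_k.+2, odd j = ~~ odd i.
  by exists (if odd i then ord0 else lift ord0 ord0); case: ifP.
have o1 : odd_perm (lift_perm j i 1) by rewrite odd_lift_perm odd_perm1 oj; case: odd.
have -> : ocls true t = ocls false (reorder t (lift_perm j i 1)).
  by rewrite ocls_reorder o1.
have -> : omit t i = omit (reorder t (lift_perm j i 1)) j.
  rewrite omit_reorder; apply: eq_from_tnth => m.
  by rewrite [RHS]tnth_mktuple perm1.
rewrite incidenceE ?oj ?addbN ?addNb //.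
apply/tuple_uniqP => a b; rewrite !tnth_mktuple.
by move/(tuple_uniqP _ ut)/perm_inj.
Qed.

(** Two orderings of one vertex set differ by a permutation, whose parity goes into the sign. *)
Lemma oriented_over_ocls k (A : {set V}) s (t : k.+1.-tuple V) :
  oriented_over A s -> uniq t -> [set x in t] = A -> exists e, s = ocls e t.
Proof.
move=> [e [t0 [u0 <- ->]]] ut /setP tE.
have /tuple_permP[p /val_inj tp] : perm_eq t0 t.
  by apply: uniq_perm => // x; have := tE x; rewrite !inE.
by exists (e (+) odd_perm p); rewrite tp -ocls_reorder.
Qed.

Lemma incidence_flip k (A B : {set V}) (tau : {set signed_ordering V k.+1}) s b b' :
  oriented_over B tau -> oriented_over A s -> A \subset B ->
  incidence (flip b tau) (flip b' s) = (-1) ^+ (b (+) b') * incidence tau s.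
Proof.
move=> [e [t [ut <- ->]]] As sAB.
have cA : #|A| = k.+1.
  by case: As => [? [t0 [u0 <- _]]]; rewrite cardsE (card_uniqP u0) size_tuple.
(* By cardinality some vertex of [t] lies outside [A]; omitting it leaves an ordering of [A], and
   the explicit sign formula applies. *)
have : ~~ ([set x in t] \subset A).
  apply/negP => /subset_leq_card.
  by rewrite cA cardsE (card_uniqP ut) size_tuple ltnn.
case/subsetPn => x; rewrite inE => /tnthP[i ->] iA.
have uo : uniq (omit t i).
  apply/tuple_uniqP => a c; rewrite !tnth_mktuple.
  by move/(tuple_uniqP _ ut)/lift_inj.
have Ao : [set y in omit t i] = A.
  apply/esym/eqP; rewrite eqEcard cA cardsE (card_uniqP uo) size_tuple leqnn andbT.
  apply/subsetP => y yA; have := subsetP sAB _ yA; rewrite !inE => /tnthP[j yj].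
  case: (unliftP i j) => [m jm|ji]; last by rewrite yj ji (negPf iA) in yA.
  by apply/tnthP; exists m; rewrite tnth_mktuple -jm.
have [e' ->] := oriented_over_ocls As uo Ao.
rewrite !flip_ocls !incidence_ocls // -signr_addb; congr (_ ^+ nat_of_bool _).
by case: b; case: b'; case: e; case: e'; case: odd.
Qed.

Lemma incidenceN1 k (tau : {set signed_ordering V k.+1}) s :
  incidence tau s = (-1) ^+ (incidence tau s == -1).
Proof. by rewrite /incidence; case: ifP. Qed.

Variable X : simplicial_complex V.

Definition switch_of (O O' : orientation X) (b : {set V} -> bool) :=
  forall k A, A \in faces X k -> O' k A = flip (b A) (O k A).

Lemma switch_orientation (O : orientation X) b : exists O', switch_of O O' b.
Proof.
have H k A : A \in faces X k -> oriented_over A (flip (b A) (O k A)).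
  move=> /(orientP O) [e [t [ut tA ->]]].
  by exists (b A (+) e), t; rewrite flip_ocls.
by exists (Orientation H).
Qed.

Lemma switch_between (O O' : orientation X) : exists b, switch_of O O' b.
Proof.
(* An orientation is indexed by the dimension while [b] sees only the face, so the dimension is
   recovered as [#|A|.-1]. *)
exists (fun A : {set V} => O' #|A|.-1 A != O #|A|.-1 A) => k A Af.
have -> : #|A|.-1 = k by move: Af; rewrite inE => /andP[_ /eqP ->].
have [e [t [ut tA ->]]] := orientP O Af.
have [e' ->] := oriented_over_ocls (orientP O' Af) ut tA.
rewrite flip_ocls; case: eqP => [->//|].
by case: e; case: e'.
Qed.

Lemma incidence_switch O O' b k A B : switch_of O O' b ->
  A \in faces X k -> B \in faces X k.+1 -> A \subset B ->
  (incidence (O' k.+1 B) (O' k A) == -1) =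
  b A (+) b B (+) (incidence (O k.+1 B) (O k A) == -1).
Proof.
move=> sw Af Bf AB; rewrite !sw // (incidence_flip _ _ (orientP O Bf) (orientP O Af)) //.
rewrite [in LHS]incidenceN1.
by case: (b A); case: (b B); case: (incidence _ _ == -1).
Qed.

Lemma sign_mul_neg k l (t : {set signed_ordering V k.+1}) s
    (t' : {set signed_ordering V l.+1}) s' :
  (incidence t s * incidence t' s' == -1) =
  (incidence t s == -1) (+) (incidence t' s' == -1).
Proof. by rewrite /incidence; do 2!case: ifP. Qed.

Lemma s_up_neg k (O : orientation X) A B :
  (s_up k O A B == -1) =
  (incidence (O k.+1 (A :|: B)) (O k A) == -1)
    (+) (incidence (O k.+1 (A :|: B)) (O k B) == -1).
Proof.
exact: sign_mul_neg.
Qed.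

Lemma s_down_neg k (O : orientation X) A B :
  (s_down k.+1 O A B == -1) =
  (incidence (O k.+1 A) (O k (A :&: B)) == -1)
    (+) (incidence (O k.+1 B) (O k (A :&: B)) == -1).
Proof.
exact: sign_mul_neg.
Qed.

(** The common coface enters both incidence numbers, so its own reversal cancels. *)
Lemma s_up_switched O O' b k C : switch_of O O' b ->
  switched C (up_adj X k) (s_up k) O O' b.
Proof.
move=> sw A B _ _ /and4P[Af Bf _ Uf]; rewrite /neg_sign !s_up_neg.
rewrite (incidence_switch sw Af Uf (subsetUl _ _)).
rewrite (incidence_switch sw Bf Uf (subsetUr _ _)).
set c := (_ == -1); set c' := (_ == -1).
by case: c; case: c'; case: (b A); case: (b B); case: (b _).
Qed.

(** Here it is the reversal of the common facet that cancels. *)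
Lemma s_down_switched O O' b k C : switch_of O O' b ->
  switched C (down_adj X k.+1) (s_down k.+1) O O' b.
Proof.
move=> sw A B _ _ /and5P[_ Af Bf _ If]; rewrite /neg_sign !s_down_neg.
rewrite (incidence_switch sw If Af (subsetIl _ _)).
rewrite (incidence_switch sw If Bf (subsetIr _ _)).
set c := (_ == -1); set c' := (_ == -1).
by case: c; case: c'; case: (b A); case: (b B); case: (b _).
Qed.

End Switching.

(** * Energies of a component *)

Section Lagrange.
Variables (R : realType) (T : finType).

Lemma lagrange_identity (P : pred T) (w g : T -> R) :
  (\sum_(i | P i) w i) * (\sum_(i | P i) w i * g i ^+ 2)
    - (\sum_(i | P i) w i * g i) ^+ 2 =
  2^-1 * \sum_(i | P i) \sum_(j | P j) w i * w j * (g i - g j) ^+ 2.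
Proof.
set a := \sum_(i | P i) w i; set b := \sum_(i | P i) w i * g i ^+ 2.
set c := \sum_(i | P i) w i * g i.
suff -> : \sum_(i | P i) \sum_(j | P j) w i * w j * (g i - g j) ^+ 2 =
    b * a + a * b - 2 * (c * c) by field.
rewrite !mulr_suml mulr_sumr -big_split -sumrB /=; apply: eq_bigr => i _.
rewrite !mulr_sumr -big_split -sumrB /=; apply: eq_bigr => j _; ring.
Qed.

Variables (P Q : {set T}) (inc adj : rel T) (join : T -> T -> T).
Hypothesis adj_irr : irreflexive adj.
Hypothesis incE : forall x y e, x \in P -> y \in P -> e \in Q -> y != x ->
  inc x e && inc y e = adj x y && (e == join x y).
Hypothesis joinQ : forall x y, adj x y -> x \in P -> join x y \in Q.

(** Distinct [x] and [y] incident to a common [e] are adjacent and determine [e] as their join, so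
    neighbours can be grouped by [e]. This serves both adjacencies, with union and with intersection
    as [join]. *)
Lemma sum_adj x (H : T -> T -> R) : x \in P ->
  \sum_(y in P | adj x y) H y (join x y) =
  \sum_(e in Q | inc x e) \sum_(y in P | inc y e && (y != x)) H y e.
Proof.
move=> xP; rewrite (exchange_big_dep (mem P)) /=; last by move=> e y _ /andP[].
rewrite big_mkcondr; apply: eq_bigr => y yP.
have [->|yx] := eqVneq y x.
  by rewrite adj_irr big_pred0 // => e; rewrite !andbF.
case: ifP => [xy|nxy]; last first.
  by apply/esym/big_pred0 => e; case eQ: (e \in Q) => //=; rewrite yP andbT incE ?nxy.
rewrite (big_pred1 (join x y)) // => e /=; rewrite yP andbT -andbA.
case eQ: (e \in Q); first by rewrite incE // xy.
by apply/esym/negbTE; apply: contraFN eQ => /eqP ->; apply: joinQ.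
Qed.

(** Vanishing on the diagonal removes the terms [y = x], which are no adjacent pairs. *)
Lemma sum_adj_pairs (G : T -> T -> T -> R) : (forall x e, G x x e = 0) ->
  \sum_(e in Q) \sum_(x in P | inc x e) \sum_(y in P | inc y e) G x y e =
  \sum_(x in P) \sum_(y in P | adj x y) G x y (join x y).
Proof.
move=> G0; rewrite (exchange_big_dep (mem P)) /=; last by move=> e y _ /andP[].
apply: eq_bigr => x xP; rewrite (sum_adj (G x)) //.
apply: eq_big => e; first by rewrite xP.
move=> /andP[_ /andP[_ xe]].
rewrite (bigD1 x) ?xP //= G0 add0r; apply: eq_bigl => y.
by rewrite andbA.
Qed.

End Lagrange.

(** * Cofaces of nonleaves, positivity of [LP] and number of facets *)

Section ComplexFacts.
Variables (V : finType) (X : simplicial_complex V).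

(** Adding to [A] one vertex of a strictly larger face already gives a face, by closure under
    subsets. *)
Lemma leafPn A : A \in X -> ~~ leaf X A -> exists B, facet X A B.
Proof.
move=> AX; rewrite /leaf AX /= => /forall_inPn[B BX]; rewrite negbK.
case/properP => sAB [x xB xA]; exists (x |: A).
rewrite /facet AX subsetUr cardsU1 xA eqxx !andbT /=.
apply: (complex_closed BX); first by rewrite subUset sub1set xB.
by apply/set0Pn; exists x; rewrite setU11.
Qed.

Lemma LP_gt0 A : A \in X -> (0 < LP X A)%N.
Proof.
rewrite /LP; elim: #|V| A => //= n IH A AX; case: ifPn => // /(leafPn AX)[B AB].
rewrite (bigD1 B) //= addn_gt0 IH //.
by case/and4P: AB.
Qed.

Lemma faces_facet k A B : A \in faces X k -> B \in faces X k.+1 ->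
  A \subset B -> facet X A B.
Proof.
rewrite !inE => /andP[AX /eqP cA] /andP[BX /eqP cB] AB.
by rewrite /facet AX BX AB cA cB eqxx.
Qed.

Lemma card_facets k B : B \in faces X k.+1 ->
  #|[set A | facet X A B]| = k.+2.
Proof.
rewrite inE => /andP[BX /eqP cB].
transitivity #|[set A : {set V} | A \subset B & #|A| == k.+1]|.
  apply: eq_card => A; rewrite !inE /facet BX cB eqSS (eq_sym k.+1) /=.
  apply: andb_idl => /andP[AB cA]; apply: (complex_closed BX) => //.
  by rewrite -card_gt0 (eqP cA).
by rewrite cards_draws cB binSn.
Qed.

End ComplexFacts.

(** * Degrees and energies of an up-component and of its cofaces *)

Section Component.
Variables (R : realType) (V : finType) (X : simplicial_complex V).
Variables (k : nat) (C : {set {set V}}).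
Hypothesis hC : up_component X k C.
Hypothesis hleaf : ~ is_single_leaf X C.
Let K := cofaces X k.+1 C.

Lemma component_face A : A \in C -> A \in faces X k.
Proof. by move: hC => /andP[_ /maxsetP[/andP[/subsetP Cf _] _]]; apply: Cf. Qed.

Lemma cofaces_face B : B \in K -> B \in faces X k.+1.
Proof. by rewrite inE => /andP[]. Qed.

Lemma component_LP_gt0 A : A \in C -> (0 < LP X A)%N.
Proof. by move/component_face; rewrite inE => /andP[AX _]; apply: LP_gt0. Qed.

Lemma cofaces_LP_gt0 A : A \in K -> (0 < LP X A)%N.
Proof. by move/cofaces_face; rewrite inE => /andP[AX _]; apply: LP_gt0. Qed.

(** With [facet_cofaces], this says that incidence does not leave the pair [C], [K], so sums over
    all facets or cofaces may be taken inside it. *)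
Lemma facet_component A B : B \in K -> facet X A B = (A \in C) && (A \subset B).
Proof.
move=> hB; apply/idP/andP => [AB|[hA AB]]; last first.
  exact: faces_facet (component_face hA) (cofaces_face hB) AB.
move: hB; rewrite inE => /andP[_ /existsP[A' /andP[hA' A'B]]].
by rewrite (facet_closed hC hA' A'B AB); case/and4P: AB.
Qed.

Lemma facet_cofaces A B : A \in C -> facet X A B = (B \in K) && (A \subset B).
Proof.
move=> hA; apply/idP/andP => [AB|[hB AB]]; last by rewrite facet_component ?hA.
case/and4P: (AB) => _ BX sAB /eqP cB; split => //.
have := component_face hA; rewrite !inE => /andP[_ /eqP cA].
by rewrite BX cB cA eqxx /=; apply/existsP; exists A; rewrite hA.
Qed.

Lemma component_neq0 : C != finset.set0.
Proof. by case/andP: hC. Qed.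

Lemma cofaces_neq0 : K != finset.set0.
Proof. by have /andP[] := cofaces_down_component (ltn0Sn k) hC hleaf. Qed.

(** A leaf has no up-neighbour, so its component would be a singleton. *)
Lemma component_nonleaf A : A \in C -> ~~ leaf X A.
Proof.
move=> hA; apply/negP => lA; apply: hleaf; exists A => //.
have /andP[_ /maxsetP[/andP[_ /forall_inP Cn] _]] := hC.
apply/eqP; rewrite eqEsubset sub1set hA andbT; apply/subsetP => B BC.
have /forall_inP /(_ _ BC) /connectP[[|D p] /= pth ->] := Cn _ hA.
  by rewrite inE.
case/andP: pth => /and4P[Af _ _ Uf] _.
have /and4P[_ UX sU /eqP cU] := faces_facet Af Uf (subsetUl _ _).
case/andP: lA => _ /forall_inP /(_ _ UX); rewrite properEcard sU cU.
by rewrite ltnSn.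
Qed.

Lemma component_LP A : A \in C ->
  (LP X A)%:R = \sum_(B in K | A \subset B) (LP X B)%:R :> R.
Proof.
move=> hA; rewrite LPE; last by have := component_face hA; rewrite inE => /andP[].
rewrite (negPf (component_nonleaf hA)) natr_sum; apply: eq_bigl => B.
exact: facet_cofaces.
Qed.

Lemma card_component_facets B : B \in K ->
  \sum_(A in C | A \subset B) 1 = k.+2%:R :> R.
Proof.
move=> hB; rewrite -(card_facets (cofaces_face hB)) -sumr_const.
by apply: eq_bigl => A; rewrite inE facet_component.
Qed.

Lemma up_adj_irr : irreflexive (up_adj X k).
Proof. by move=> A; rewrite /up_adj eqxx /= !andbF. Qed.

Lemma down_adj_irr : irreflexive (down_adj X k.+1).
Proof. by move=> A; rewrite /down_adj eqxx /= !andbF. Qed.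

(** The union of two distinct [k]-faces in [B] is too large to be anything but [B]. *)
Lemma up_incE A A' B : A \in C -> A' \in C -> B \in K -> A' != A ->
  (A \subset B) && (A' \subset B) = up_adj X k A A' && (B == A :|: A').
Proof.
move=> hA hA' hB nAA'; apply/andP/andP => [[AB A'B]|[_ /eqP ->]]; last first.
  by rewrite subsetUl subsetUr.
have Af := component_face hA; have A'f := component_face hA'.
have Bf := cofaces_face hB.
suff BE : B = A :|: A' by rewrite /up_adj Af A'f eq_sym nAA' -BE Bf.
move: Af A'f Bf; rewrite !inE => /andP[_ /eqP cA] /andP[_ /eqP cA'] /andP[_ /eqP cB].
apply/esym/eqP; rewrite eqEcard subUset AB A'B cB -cA /=.
apply: proper_card; rewrite properEneq subsetUl andbT.
apply: contra nAA' => /eqP E; rewrite eqEcard cA cA' leqnn andbT.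
by rewrite E subsetUr.
Qed.

Lemma up_adj_cofaces A A' : up_adj X k A A' -> A \in C -> A :|: A' \in K.
Proof.
move=> /and4P[Af _ _ Uf] hA; have := faces_facet Af Uf (subsetUl _ _).
by rewrite facet_cofaces // => /andP[].
Qed.

Lemma down_incE B B' A : B \in K -> B' \in K -> A \in C -> B' != B ->
  (A \subset B) && (A \subset B') = down_adj X k.+1 B B' && (A == B :&: B').
Proof.
move=> hB hB' hA nBB'; apply/andP/andP => [[AB AB']|[_ /eqP ->]]; last first.
  by rewrite subsetIl subsetIr.
have Bf := cofaces_face hB; have B'f := cofaces_face hB'.
have Af := component_face hA.
suff AE : A = B :&: B' by rewrite /down_adj Bf B'f eq_sym nBB' -AE Af.
move: Bf B'f Af; rewrite !inE => /andP[_ /eqP cB] /andP[_ /eqP cB'] /andP[_ /eqP cA].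
apply/eqP; rewrite eqEcard subsetI AB AB' /= cA -ltnS -cB.
apply: proper_card; rewrite properEneq subsetIl andbT.
apply: contra nBB' => /eqP E; rewrite eq_sym eqEcard cB cB' leqnn andbT.
by rewrite -E subsetIr.
Qed.

Lemma down_adj_component B B' : down_adj X k.+1 B B' -> B \in K ->
  B :&: B' \in C.
Proof.
move=> /and5P[_ Bf _ _ If] hB; have := faces_facet If Bf (subsetIl _ _).
by rewrite facet_component // => /andP[].
Qed.

(** Each coface [B] of [A] has [k.+1] further facets, all joined to [A] with weight [LP X B]. As [C]
    has dimension [k] here, [k.+1] is the [k] of the theorem. *)
Lemma up_degree A : A \in C ->
  \sum_(A' in C | up_adj X k A A') omega_up R X A A' = k.+1%:R * (LP X A)%:R.
Proof.
move=> hA.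
rewrite (sum_adj (inc := fun A B : {set V} => A \subset B)
  (join := fun A B => A :|: B) up_adj_irr up_incE up_adj_cofaces
  (fun _ B => (LP X B)%:R)) //.
rewrite component_LP // mulr_sumr; apply: eq_bigr => B /andP[hB AB].
have := card_component_facets hB; rewrite (bigD1 A) ?hA //= => E.
have -> : k.+1%:R = \sum_(A' in C | (A' \subset B) && (A' != A)) 1 :> R.
  apply: (addrI 1); rewrite -mulrS -E; congr (_ + _).
  by apply: eq_bigl => A'; rewrite andbA.
by rewrite mulr_suml; apply: eq_bigr => A' _; rewrite mul1r.
Qed.

(** Through a facet [A] of [B], the other cofaces of [A] have total weight [LP X A - LP X B] by
    [component_LP]; summing over the [k.+2] facets gives the formula. *)
Lemma down_degree B : B \in K ->
  \sum_(B' in K | down_adj X k.+1 B B') omega_down R X B B' =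
  (k.+2%:R - (LP X B)%:R * \sum_(A | facet X A B) ((LP X A)%:R)^-1)
    * (LP X B)%:R.
Proof.
move=> hB.
rewrite (sum_adj (inc := fun B A : {set V} => A \subset B)
  (join := fun A B => A :&: B) down_adj_irr down_incE down_adj_component
  (fun B' A => (LP X B)%:R * (LP X B')%:R / (LP X A)%:R)) //.
rewrite -(card_component_facets hB) mulr_sumr.
rewrite [X in _ - X](eq_bigl (fun A => (A \in C) && (A \subset B))); last first.
  by move=> A; rewrite facet_component.
rewrite -sumrB mulr_suml; apply: eq_bigr => A /andP[hA AB].
have A0 : (LP X A)%:R != 0 :> R by rewrite pnatr_eq0 -lt0n component_LP_gt0.
have -> : \sum_(B' in K | (A \subset B') && (B' != B))
    (LP X B)%:R * (LP X B')%:R / (LP X A)%:R =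
    (LP X B)%:R / (LP X A)%:R * ((LP X A)%:R - (LP X B)%:R) :> R.
  rewrite [X in _ * (X - _)]component_LP // [in RHS](bigD1 B) ?hB //=.
  rewrite [X in _ = _ * X]addrC addKr.
  rewrite mulr_sumr; apply: eq_big => [B'|B' _]; first by rewrite andbA.
  by rewrite mulrAC.
by field.
Qed.

Lemma down_degree_le B : B \in K ->
  \sum_(B' in K | down_adj X k.+1 B B') omega_down R X B B' <=
  d_down R X k.+1 K * (LP X B)%:R.
Proof.
move=> hB; rewrite down_degree // ler_wpM2r // lerD2l lerN2.
apply: ge_inf; last by exists B.
(* The infimum in [d_down] is below each element only once the set is known to be bounded below. *)
exists 0 => r [A AK ->]; rewrite mulr_ge0 // sumr_ge0 // => D _.
by rewrite invr_ge0.
Qed.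

Lemma omega_down_ge0 A B : 0 <= omega_down R X A B.
Proof. by rewrite divr_ge0 // mulr_ge0. Qed.

Lemma d_down_ge0 : 0 <= d_down R X k.+1 K.
Proof.
have /set0Pn[B hB] := cofaces_neq0; have := down_degree_le hB.
have : 0 <= \sum_(B' in K | down_adj X k.+1 B B') omega_down R X B B'.
  by apply: sumr_ge0 => B' _; apply: omega_down_ge0.
move=> /le_trans H /H; rewrite pmulr_lge0 // ltr0n; exact: cofaces_LP_gt0.
Qed.

Variable O : orientation X.

Definition eps A B : R := (incidence (O k.+1 B) (O k A))%:~R.

Lemma epsE A B : eps A B = (-1) ^+ (incidence (O k.+1 B) (O k A) == -1).
Proof. by rewrite /eps {1}incidenceN1 rmorphXn rmorphN1. Qed.

Lemma eps_sqr A B : eps A B ^+ 2 = 1.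
Proof. by rewrite epsE sqrr_sign. Qed.

Lemma sign_diff (b b' : bool) (x y : R) :
  ((-1) ^+ b * x - (-1) ^+ b' * y) ^+ 2 = (x - (-1) ^+ (b (+) b') * y) ^+ 2.
Proof. by case: b; case: b' => /=; rewrite ?expr0 ?expr1; ring. Qed.

(** Lagrange identity with unit weights on the [k.+2] facets of each [B], scaled by [LP X B]. The
    two incidence signs multiply to [s_up]. *)
Lemma up_energy f :
  k.+2%:R * \sum_(A in C) (LP X A)%:R * f A ^+ 2
    - \sum_(B in K) (LP X B)%:R *
        (\sum_(A in C | A \subset B) eps A B * f A) ^+ 2 =
  2^-1 * energy C (up_adj X k) (omega_up R X) (neg_sign (s_up k) O) f.
Proof.
have -> : \sum_(A in C) (LP X A)%:R * f A ^+ 2 =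
    \sum_(B in K) (LP X B)%:R * \sum_(A in C | A \subset B) f A ^+ 2 :> R.
  under [RHS]eq_bigr do rewrite mulr_sumr.
  rewrite [RHS](exchange_big_dep (mem C)) /=; last by move=> B A _ /andP[].
  apply: eq_bigr => A hA; rewrite component_LP // mulr_suml.
  by apply: eq_bigl => B; rewrite hA.
pose G A A' B := (LP X B)%:R * (eps A B * f A - eps A' B * f A') ^+ 2.
have -> : energy C (up_adj X k) (omega_up R X) (neg_sign (s_up k) O) f =
    \sum_(A in C) \sum_(A' in C | up_adj X k A A') G A A' (A :|: A').
  apply: eq_bigr => A hA; apply: eq_bigr => A' _.
  by rewrite /G !epsE sign_diff -s_up_neg.
rewrite -(sum_adj_pairs (inc := fun A B : {set V} => A \subset B)
  up_adj_irr up_incE up_adj_cofaces); last first.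
  by move=> A B; rewrite /G subrr expr0n mulr0.
rewrite !mulr_sumr -sumrB; apply: eq_bigr => B hB.
have := lagrange_identity (fun A => (A \in C) && (A \subset B)) (fun=> 1 : R)
  (fun A => eps A B * f A).
rewrite card_component_facets //.
under eq_bigr do rewrite mul1r exprMn eps_sqr mul1r.
under [X in _ - X ^+ 2]eq_bigr do rewrite mul1r.
rewrite mulrCA -mulrBr => ->; rewrite mulrCA; congr (_ * _).
rewrite mulr_sumr; apply: eq_bigr => A _; rewrite mulr_sumr.
by apply: eq_bigr => A' _; rewrite !mul1r.
Qed.

(** Lagrange identity with weights [LP X B] on the cofaces of each [A]. Their total is [LP X A], by
    which everything is divided. *)
Lemma down_energy f :
  k.+2%:R * \sum_(B in K) (LP X B)%:R * f B ^+ 2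
    - \sum_(A in C) (LP X A)%:R^-1 *
        (\sum_(B in K | A \subset B) (LP X B)%:R * (eps A B * f B)) ^+ 2 =
  2^-1 * energy K (down_adj X k.+1) (omega_down R X) (neg_sign (s_down k.+1) O) f.
Proof.
have -> : k.+2%:R * \sum_(B in K) (LP X B)%:R * f B ^+ 2 =
    \sum_(A in C) \sum_(B in K | A \subset B) (LP X B)%:R * f B ^+ 2 :> R.
  rewrite [RHS](exchange_big_dep (mem K)) /=; last by move=> B A _ /andP[].
  rewrite mulr_sumr; apply: eq_bigr => B hB; rewrite -(card_component_facets hB).
  rewrite mulr_suml; apply: eq_big => A; first by rewrite hB.
  by rewrite mul1r.
pose G B B' A := (LP X B)%:R * (LP X B')%:R / (LP X A)%:R *
  (eps A B * f B - eps A B' * f B') ^+ 2.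
have -> : energy K (down_adj X k.+1) (omega_down R X) (neg_sign (s_down k.+1) O) f =
    \sum_(B in K) \sum_(B' in K | down_adj X k.+1 B B') G B B' (B :&: B').
  apply: eq_bigr => A hA; apply: eq_bigr => A' _.
  by rewrite /G !epsE sign_diff -s_down_neg.
rewrite -(sum_adj_pairs (inc := fun B A : {set V} => A \subset B)
  down_adj_irr down_incE down_adj_component); last first.
  by move=> A B; rewrite /G subrr expr0n mulr0.
rewrite !mulr_sumr -sumrB; apply: eq_bigr => A hA.
have A0 : (LP X A)%:R != 0 :> R by rewrite pnatr_eq0 -lt0n component_LP_gt0.
have := lagrange_identity (fun B => (B \in K) && (A \subset B))
  (fun B => (LP X B)%:R : R) (fun B => eps A B * f B).
rewrite -component_LP //.
under eq_bigr do rewrite exprMn eps_sqr mul1r.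
move=> E; apply: (mulfI A0); rewrite mulrBr mulrA divff // mul1r E.
rewrite mulrCA; congr (_ * _); rewrite mulr_sumr; apply: eq_bigr => B _.
by rewrite mulr_sumr; apply: eq_bigr => B' _; rewrite /G; field.
Qed.

End Component.

(** * Spectral bounds *)

Section SpectralBounds.
Variables (R : realType) (V : finType) (X : simplicial_complex V).
Variables (C : {set {set V}}) (n : nat) (g : 'I_n -> {set V}) (M : 'M[R]_n).
Hypothesis g_inj : injective g.
Hypothesis sum_g : forall F : {set V} -> R, \sum_i F (g i) = \sum_(A in C) F A.
Variables (r : {set V} -> R) (c kappa h d : R) (E : ({set V} -> R) -> R).
Hypothesis n_gt0 : (0 < n)%N.
Hypothesis M_sym : M^T = M.
Hypothesis c_gt0 : 0 < c.
Hypothesis kappa_gt0 : 0 < kappa.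
Hypothesis d_ge0 : 0 <= d.
Hypothesis r_neq0 : forall i, r (g i) != 0.
Hypothesis r_sqr : forall A, A \in C -> c * r A ^+ 2 = (LP X A)%:R.
Let S f : R := \sum_(A in C) (LP X A)%:R * f A ^+ 2.
(** The substitution of [W^(1/2) f] for a vector: [r] stands for the square root of the weight and
    [c] for the factorial in its denominator. *)
Let vec f : 'rV[R]_n := \row_i (r (g i) * f (g i)).
Hypothesis E_ge0 : forall f, 0 <= E f.
Hypothesis quad_vec : forall f,
  c * kappa * quad M (vec f) = kappa * S f - 2^-1 * E f.
Hypothesis E_lower : 0 < d -> forall f, h ^+ 2 * S f <= d * E f.
Hypothesis E_upper : exists f, 0 < S f /\ E f <= 4 * h * S f.

Lemma normsq_vec f : c * normsq (vec f) = S f.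
Proof.
rewrite /normsq.
transitivity (c * \sum_i (r (g i) * f (g i)) ^+ 2).
  by congr (_ * _); apply: eq_bigr => i _; rewrite mxE.
rewrite (sum_g (fun A => (r A * f A) ^+ 2)) mulr_sumr; apply: eq_bigr => A hA.
by rewrite -r_sqr // exprMn mulrA.
Qed.

Lemma vec_surj (v : 'rV[R]_n) : exists f, v = vec f.
Proof.
(* The value 0 is a default for sets outside the range of [g]. *)
exists (fun A => if [pick i | g i == A] is Some i then v 0 i / r A else 0).
apply/rowP => i; rewrite mxE; case: pickP => [j /eqP /g_inj ->|/(_ i)].
  by rewrite mulrCA divff // mulr1.
by rewrite eqxx.
Qed.

(** For [f] representing a top eigenvector, [quad_vec] becomes [2 * kappa * (1 - lambda_max M) * S f
    = E f], to which [E_lower] applies. *)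
Lemma lambda_max_lower : h ^+ 2 / d / (2 * kappa) <= 1 - lambda_max M.
Proof.
have [_ [v v0 vE]] := lambda_maxP n_gt0 M_sym.
have [f fE] := vec_surj v; have nv := normsq_gt0 v0.
have qv : quad M v = lambda_max M * normsq v.
  by rewrite /quad vE -scalemxAl mxE -normsqE.
have := quad_vec f; rewrite -fE qv -normsq_vec -fE.
set l := lambda_max M; set N := normsq v => H.
have N0 : 0 < c * N by rewrite mulr_gt0.
have HE : (1 - l) * (2 * kappa) * (c * N) = E f by lra.
have k2 : 0 < 2 * kappa by rewrite mulr_gt0.
rewrite ler_pdivrMr // -(ler_pM2r N0) HE.
(* Division by 0 gives 0, so for [d = 0] the claim is [E_ge0]. *)
have [d0|d0] := eqVneq d 0; first by rewrite d0 invr0 mulr0 mul0r.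
have dp : 0 < d by rewrite lt0r d0.
have := E_lower dp f; rewrite -normsq_vec -fE -/N => H2.
by rewrite mulrAC ler_pdivrMr // mulrC (mulrC _ d) mulrC.
Qed.

Lemma lambda_max_upper : 1 - lambda_max M <= 2 * h / kappa.
Proof.
have [ray _] := lambda_maxP n_gt0 M_sym.
have [f [S0 Ef]] := E_upper; have := ray (vec f); set l := lambda_max M => H.
have ck : 0 < c * kappa by rewrite mulr_gt0.
have := ler_wpM2l (ltW ck) H; rewrite quad_vec.
have -> : c * kappa * (l * normsq (vec f)) = l * kappa * S f.
  by rewrite -normsq_vec; ring.
move=> H2; rewrite ler_pdivlMr // -(ler_pM2r S0); lra.
Qed.

End SpectralBounds.

(** * Indexing principal submatrices by faces *)

Section Restriction.
Variables (R : realType) (V : finType) (X : simplicial_complex V).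
Implicit Types C : {set {set V}}.

(** Two enumerations are composed: an index of the submatrix gives an index among all [k]-faces,
    which gives a face. *)
Definition face_in k C (i : 'I_#|[set i : 'I_#|faces X k| | face_of i \in C]|) :
  {set V} := face_of (enum_val i).

Lemma face_in_inj k C : injective (@face_in k C).
Proof. by move=> i j /enum_val_inj /enum_val_inj. Qed.

Lemma face_in_mem k C (i : 'I_#|[set i : 'I_#|faces X k| | face_of i \in C]|) :
  face_in i \in C.
Proof. by have := enum_valP i; rewrite inE. Qed.

Lemma sum_face_in k C (F : {set V} -> R) : C \subset faces X k ->
  \sum_i F (@face_in k C i) = \sum_(A in C) F A.
Proof.
move=> /subsetP Cf.
rewrite -(big_enum_val (fun i : 'I_#|faces X k| => F (face_of i))).
rewrite (eq_bigl (fun i => face_of i \in C)); last by move=> i; rewrite inE.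
rewrite -(big_enum_val_cond (fun A => A \in C) F).
by apply: eq_bigl => A; apply: andb_idl => /Cf.
Qed.

Lemma card_face_in k C : C \subset faces X k -> C != finset.set0 ->
  (0 < #|[set i : 'I_#|faces X k| | face_of i \in C]|)%N.
Proof.
move=> /subsetP Cf /set0Pn[A hA]; rewrite card_gt0; apply/set0Pn.
exists (enum_rank_in (Cf _ hA) A); rewrite inE /face_of enum_rankK_in //.
exact: Cf.
Qed.

End Restriction.

(** * The restricted Laplacians and their bounds *)

Section Main.
Variables (R : realType) (V : finType) (X : simplicial_complex V).
Variables (O : orientation X) (k : nat) (C : {set {set V}}).
Hypothesis hC : up_component X k C.
Hypothesis hleaf : ~ is_single_leaf X C.
Let K := cofaces X k.+1 C.

Let Cf : C \subset faces X k.
Proof. by apply/subsetP => A; apply: component_face. Qed.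

Let Kf : K \subset faces X k.+1.
Proof. by apply/subsetP => A; apply: cofaces_face. Qed.

Definition block :
    'M[R]_(#|[set i : 'I_#|faces X k.+1| | face_of i \in K]|,
           #|[set i : 'I_#|faces X k| | face_of i \in C]|) :=
  mxsub (fun i => enum_val i) (fun i => enum_val i) (delta R O k).

Lemma deltaE i j : delta R O k i j =
  if face_of j \subset face_of i then
    Num.sqrt (weight R X k.+1 (face_of i)) * eps R k O (face_of j) (face_of i)
      / Num.sqrt (weight R X k (face_of j)) else 0.
Proof.
rewrite /delta /W_sqrt /W_sqrtV mul_diag_mx mul_mx_diag !mxE.
by case: ifP => // _; rewrite mulr0 mul0r.
Qed.

Lemma blockE i j : block i j =
  if face_in j \subset face_in i then
    Num.sqrt (weight R X k.+1 (face_in i)) * eps R k O (face_in j) (face_in i)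
      / Num.sqrt (weight R X k (face_in j)) else 0.
Proof. by rewrite mxE deltaE. Qed.

(** The product sums over all [k.+1]-faces, but only those in [K] contain a face of [C], so the
    other terms vanish. *)
Lemma restrict_up : restrict (Delta_up R O k) C = block^T *m block.
Proof.
apply/matrixP => i j; rewrite !mxE.
transitivity (\sum_(t in [set t : 'I_#|faces X k.+1| | face_of t \in K])
    delta R O k t (enum_val i) * delta R O k t (enum_val j)); last first.
  by rewrite big_enum_val; apply: eq_bigr => t _; rewrite !mxE.
rewrite [RHS]big_mkcond; apply: eq_bigr => t _; rewrite mxE inE.
case: ifPn => // tK; rewrite deltaE; case: ifP => [sit|]; last by rewrite mul0r.
have tf : face_of t \in faces X k.+1 by apply: enum_valP.
have iC := face_in_mem i.
have := faces_facet (component_face hC iC) tf sit.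
by rewrite (facet_cofaces hC) // (negPf tK).
Qed.

Lemma restrict_down : restrict (Delta_down R O k.+1) K = block *m block^T.
Proof.
apply/matrixP => i j; rewrite !mxE.
transitivity (\sum_(t in [set t : 'I_#|faces X k| | face_of t \in C])
    delta R O k (enum_val i) t * delta R O k (enum_val j) t); last first.
  by rewrite big_enum_val; apply: eq_bigr => t _; rewrite !mxE.
rewrite [RHS]big_mkcond; apply: eq_bigr => t _; rewrite [_^T _ _]mxE inE.
case: ifPn => // tC; rewrite deltaE; case: ifP => [sit|]; last by rewrite mul0r.
have tf : face_of t \in faces X k by apply: enum_valP.
have iK := face_in_mem i.
have := faces_facet tf (cofaces_face iK) sit.
by rewrite (facet_component hC) // (negPf tC).
Qed.

Lemma weight_gt0 l A : A \in X -> 0 < weight R X l A.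
Proof. by move=> AX; rewrite divr_gt0 // ltr0n ?fact_gt0 // LP_gt0. Qed.

Lemma sqrt_weight_sqr l A : Num.sqrt (weight R X l A) ^+ 2 = weight R X l A.
Proof. by rewrite sqr_sqrtr // divr_ge0. Qed.

Lemma sqrt_weight_neq0 l l' A : A \in faces X l ->
  Num.sqrt (weight R X l' A) != 0.
Proof.
rewrite inE => /andP[AX _].
by rewrite lt0r_neq0 // sqrtr_gt0 weight_gt0.
Qed.

Lemma factR l : (l`!)%:R != 0 :> R.
Proof. by rewrite pnatr_eq0 -lt0n fact_gt0. Qed.

Lemma weightK l A : (l.+1)`!%:R * weight R X l A = (LP X A)%:R.
Proof. by rewrite mulrC divfK // factR. Qed.

Lemma quad_up f :
  (k.+1)`!%:R * k.+2%:R * quad (restrict (Delta_up R O k) C)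
     (\row_i (Num.sqrt (weight R X k (face_in i)) * f (face_in i))) =
  k.+2%:R * (\sum_(A in C) (LP X A)%:R * f A ^+ 2) -
  2^-1 * energy C (up_adj X k) (omega_up R X) (neg_sign (s_up k) O) f.
Proof.
rewrite -(up_energy hC hleaf) subKr restrict_up -{2}(trmxK block) quad_mulmx_tr.
(* The product [(k+1)! (k+2) = (k+2)!] is the denominator of the weight of a [k.+1]-face. *)
rewrite -natrM mulnC -factS; set v := \row_i _.
have vE a : (v *m block^T) 0 a = Num.sqrt (weight R X k.+1 (face_in a)) *
    \sum_(A in C | A \subset face_in a) eps R k O A (face_in a) * f A.
  rewrite mxE big_mkcondr /= -(sum_face_in _ Cf) mulr_sumr.
  apply: eq_bigr => b _; rewrite mxE [block^T _ _]mxE blockE.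
  case: ifP => // _; last by rewrite !mulr0.
  have b0 := sqrt_weight_neq0 k (component_face hC (face_in_mem b)).
  by field.
rewrite /normsq mulr_sumr.
rewrite -(sum_face_in (fun B => (LP X B)%:R *
  (\sum_(A in C | A \subset B) eps R k O A B * f A) ^+ 2) Kf).
by apply: eq_bigr => a _; rewrite vE exprMn sqrt_weight_sqr mulrA weightK.
Qed.

Lemma quad_down f :
  (k.+2)`!%:R * k.+2%:R * quad (restrict (Delta_down R O k.+1) K)
     (\row_i (Num.sqrt (weight R X k.+1 (face_in i)) * f (face_in i))) =
  k.+2%:R * (\sum_(B in K) (LP X B)%:R * f B ^+ 2) -
  2^-1 * energy K (down_adj X k.+1) (omega_down R X) (neg_sign (s_down k.+1) O) f.
Proof.
rewrite -(down_energy hC hleaf) subKr restrict_down quad_mulmx_tr.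
set v := \row_i _.
have vE b : (v *m block) 0 b = (k.+2)`!%:R^-1 *
    (Num.sqrt (weight R X k (face_in b)))^-1 *
    \sum_(B in K | face_in b \subset B) (LP X B)%:R * (eps R k O (face_in b) B * f B).
  rewrite mxE big_mkcondr /= -(sum_face_in _ Kf) mulr_sumr.
  apply: eq_bigr => a _; rewrite mxE blockE.
  case: ifP => // _; last by rewrite !mulr0.
  have b0 := sqrt_weight_neq0 k (component_face hC (face_in_mem b)).
  have -> : (LP X (face_in a))%:R =
      (k.+2)`!%:R * Num.sqrt (weight R X k.+1 (face_in a)) ^+ 2.
    by rewrite sqrt_weight_sqr weightK.
  have := factR k.+2; set q := _%:R => q0.
  by field; rewrite b0 q0.
rewrite /normsq mulr_sumr.
rewrite -(sum_face_in (fun A => (LP X A)%:R^-1 *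
  (\sum_(B in K | A \subset B) (LP X B)%:R * (eps R k O A B * f B)) ^+ 2) Cf).
apply: eq_bigr => b _; rewrite vE !exprMn mulrA; congr (_ * _).
(* Of [(k+2)! (k+2) / (k+2)!^2] there remains [1 / (k+1)!], which together with the inverse weight
   makes the inverse of [LP]. *)
rewrite !exprVn sqrt_weight_sqr -(weightK k) factS natrM invfM.
have w0 : weight R X k (face_in b) != 0.
  rewrite lt0r_neq0 // weight_gt0 //.
  by have := component_face hC (face_in_mem b); rewrite inE => /andP[].
have := factR k.+1; have : k.+2%:R != 0 :> R by rewrite pnatr_eq0.
move: w0; move: (weight _ _ _ _) (k.+1)`!%:R k.+2%:R => w x y w0 y0 x0.
by field; rewrite w0 x0 y0.
Qed.

Let lup : R := lambda_max (restrict (Delta_up R O k) C).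
Let ldown : R := lambda_max (restrict (Delta_down R O k.+1) K).
Let hup := h_up R X k C.
Let hdown := h_down R X k.+1 K.

Lemma lambda_up_down : lup = ldown.
Proof.
rewrite /lup /ldown restrict_up restrict_down lambda_max_mulmxC //.
  exact: card_face_in Kf (cofaces_neq0 hC hleaf).
exact: card_face_in Cf (component_neq0 hC).
Qed.

Lemma omega_upC A B : omega_up R X A B = omega_up R X B A.
Proof. by rewrite /omega_up setUC. Qed.

Lemma omega_downC A B : omega_down R X A B = omega_down R X B A.
Proof. by rewrite /omega_down setIC (mulrC (LP X A)%:R). Qed.

Lemma up_bounds : hup ^+ 2 / k.+1%:R / (2 * k.+2%:R) <= 1 - lup /\
  1 - lup <= 2 * hup / k.+2%:R.
Proof.
have n0 := card_face_in Cf (component_neq0 hC).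
have sM : (restrict (Delta_up R O k) C)^T = restrict (Delta_up R O k) C.
  by rewrite restrict_up trmx_mul trmxK.
have r0 i : Num.sqrt (weight R X k (@face_in _ X k C i)) != 0.
  exact: sqrt_weight_neq0 (component_face hC (face_in_mem i)).
have rS A : A \in C ->
    (k.+1)`!%:R * Num.sqrt (weight R X k A) ^+ 2 = (LP X A)%:R.
  by move=> _; rewrite sqrt_weight_sqr weightK.
have fp : 0 < (k.+1)`!%:R :> R by rewrite ltr0n fact_gt0.
have kp : 0 < k.+2%:R :> R by rewrite ltr0n.
have sw1 (Q : orientation X) b : exists Q', switched C (up_adj X k) (s_up k) Q Q' b.
  by have [Q' sw] := switch_orientation Q b; exists Q'; exact: (s_up_switched sw).
have sw2 (Q Q' : orientation X) : exists b, switched C (up_adj X k) (s_up k) Q Q' b.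
  by have [b sw] := switch_between Q Q'; exists b; exact: (s_up_switched sw).
have w0 A B : 0 <= omega_up R X A B by [].
have low : 0 < k.+1%:R :> R -> forall f,
    hup ^+ 2 * (\sum_(A in C) (LP X A)%:R * f A ^+ 2) <= k.+1%:R *
      energy C (up_adj X k) (omega_up R X) (neg_sign (s_up k) O) f.
  move=> k0 f; apply: (cheeger_le_energy (@up_adj_sym _ X k) omega_upC w0
    (component_neq0 hC) (component_LP_gt0 hC) sw1 _ _ k0) => A hA.
  by rewrite (up_degree R hC hleaf hA).
have upp := energy_le_cheeger (@up_adj_sym _ X k) omega_upC w0
    (component_neq0 hC) (component_LP_gt0 hC) sw2 O.
split.
  exact: (lambda_max_lower (@face_in_inj _ X k C) (fun F => sum_face_in F Cf)
    n0 sM fp kp (ler0n _ _) r0 rS (energy_ge0 _ _ w0 _) quad_up low).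
exact: (lambda_max_upper (fun F => sum_face_in F Cf) n0 sM fp kp rS quad_up upp).
Qed.

Lemma down_bounds :
  hdown ^+ 2 / d_down R X k.+1 K / (2 * k.+2%:R) <= 1 - ldown /\
  1 - ldown <= 2 * hdown / k.+2%:R.
Proof.
have K0 := cofaces_neq0 hC hleaf.
have n0 := card_face_in Kf K0.
have sM : (restrict (Delta_down R O k.+1) K)^T = restrict (Delta_down R O k.+1) K.
  by rewrite restrict_down trmx_mul trmxK.
have r0 i : Num.sqrt (weight R X k.+1 (@face_in _ X k.+1 K i)) != 0.
  exact: sqrt_weight_neq0 (cofaces_face (face_in_mem i)).
have rS A : A \in K ->
    (k.+2)`!%:R * Num.sqrt (weight R X k.+1 A) ^+ 2 = (LP X A)%:R.
  by move=> _; rewrite sqrt_weight_sqr weightK.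
have fp : 0 < (k.+2)`!%:R :> R by rewrite ltr0n fact_gt0.
have kp : 0 < k.+2%:R :> R by rewrite ltr0n.
have sw1 (Q : orientation X) b : exists Q', switched K (down_adj X k.+1) (s_down k.+1) Q Q' b.
  by have [Q' sw] := switch_orientation Q b; exists Q'; exact: (s_down_switched sw).
have sw2 (Q Q' : orientation X) : exists b, switched K (down_adj X k.+1) (s_down k.+1) Q Q' b.
  by have [b sw] := switch_between Q Q'; exists b; exact: (s_down_switched sw).
have w0 A B := omega_down_ge0 R X A B.
have low : 0 < d_down R X k.+1 K -> forall f,
    hdown ^+ 2 * (\sum_(A in K) (LP X A)%:R * f A ^+ 2) <= d_down R X k.+1 K *
      energy K (down_adj X k.+1) (omega_down R X) (neg_sign (s_down k.+1) O) f.
  move=> d0 f; apply: (cheeger_le_energy (@down_adj_sym _ X k.+1) omega_downC w0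
    K0 (@cofaces_LP_gt0 _ X k C) sw1 _ _ d0) => A hA.
  exact: down_degree_le hC hleaf _ hA.
have upp := energy_le_cheeger (@down_adj_sym _ X k.+1) omega_downC w0
    K0 (@cofaces_LP_gt0 _ X k C) sw2 O.
split.
  exact: (lambda_max_lower (@face_in_inj _ X k.+1 K) (fun F => sum_face_in F Kf)
    n0 sM fp kp (d_down_ge0 R hC hleaf) r0 rS (energy_ge0 _ _ w0 _)
    quad_down low).
exact: (lambda_max_upper (fun F => sum_face_in F Kf) n0 sM fp kp rS quad_down upp).
Qed.

End Main.

Theorem theorem2p20 (R : realType) (V : finType) (X : simplicial_complex V)
    (O : orientation X) (k : nat) (hk : (1 <= k <= complex_dim X)%N)
    (C : {set {set V}}) (hC : up_component X k.-1 C)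
    (hleaf : ~ is_single_leaf X C) :
  let Ck := cofaces X k C in
  let hup : R := h_up R X k.-1 C in
  let hdown : R := h_down R X k Ck in
  let lup : R := lambda_max (restrict (Delta_up R O k.-1) C) in
  let ldown : R := lambda_max (restrict (Delta_down R O k) Ck) in
  [/\ Num.max (hup ^+ 2 / k%:R) (hdown ^+ 2 / d_down R X k Ck)
        / (2 * k.+1%:R) <= 1 - lup,
      1 - lup = 1 - ldown
    & 1 - ldown <= 2 * Num.min hup hdown / k.+1%:R].
Proof.
case: k hk hC => // k _ /= hC.
have [ul uu] := up_bounds R O hC hleaf.
have [dl du] := down_bounds R O hC hleaf.
have E := lambda_up_down R O hC hleaf.
split.
(* The maximum is one of its two arguments, and equality of the eigenvalues carries the down bound
   to the up side. *)
- by rewrite maxEle; case: ifP => _; [rewrite E; exact: dl | exact: ul].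
- by rewrite E.
- by rewrite minEle; case: ifP => _; [rewrite -E; exact: uu | exact: du].
Qed.
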